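(* Let $S\ni\infty$ be a finite set of places of $\mathbb Q$ and $n=\#S-1$. (i) The space $\mathcal Y_S$ is locally compact and has dimension $\#S$. (ii) The action of $\mathbb R^n$ by translations on the space $\mathcal Y_S$ defines a codimension $1$ lamination of $\mathcal Y_S$, with the space of leaves being $Y_S$.
   Context: $\mathbb A_S=\prod_{v\in S}\mathbb Q_v$. $\Gamma=\{\pm p_1^{n_1}\cdots p_n^{n_n}\mid n_j\in\mathbb Z\}\cong\mathbb Z^n\times\{\pm1\}$, where $p_1,\dots,p_n$ are the primes in $S$; it acts on $\mathbb A_S$ by diagonal multiplication. $Y_S=\Gamma\backslash\mathbb A_S$. The universal space for proper actions of $\Gamma$ is $\underline{E\Gamma}=\mathbb R^n$, on which $\mathbb Z^n$ acts by translations ($\pm p_1^{n_1}\cdots p_n^{n_n}$ translating by $(n_1,\dots,n_n)$) and $\{\pm1\}$ acts trivially. $\mathcal Y_S=\Gamma\backslash(\mathbb A_S\times\underline{E\Gamma})$ is the quotient of $\prod_{v\in S}\mathbb Q_v\times\mathbb R^n$ by the diagonal action of $\Gamma$. The group $\mathbb R^n$ acts on $\mathcal Y_S$ by translations of the second factor. Dimension means topological dimension (each $\mathbb Q_p$ being totally disconnected of dimension $0$); the leaves of the lamination are the orbits of the $\mathbb R^n$-action. *)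

(* Defs.v *)
From HB Require Import structures.
From Stdlib Require Import Relations.
From mathcomp Require Import all_boot all_order all_algebra finmap.
From mathcomp Require Import generic_quotient ring_quotient.
From mathcomp Require Import all_classical all_reals all_analysis.
From mathcomp Require Import ring lra zify.

Set Implicit Arguments.
Unset Strict Implicit.
Unset Printing Implicit Defensive.

Import Order.TTheory GRing.Theory Num.Theory.
Import numFieldNormedType.Exports.

Local Open Scope classical_set_scope.
Local Open Scope ring_scope.

Notation prime_nat := {p : nat | prime p}.

Section PadicAbs.
Variables (R : realType) (p : prime_nat).

Definition padic_val (q : rat) : int :=
  (logn (val p) `|numq q|)%:Z - (logn (val p) `|denq q|)%:Z.

Definition padic_abs (q : rat) : R :=
  if q == 0 then 0 else ((val p)%:R : R) ^ (- padic_val q).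

Local Notation P := (val p).

Lemma prime_gt1R : 1 < P%:R :> R.
Proof. by rewrite ltr1n prime_gt1 // (valP p). Qed.

Lemma prime_gt0R : 0 < P%:R :> R.
Proof. exact: lt_trans ltr01 prime_gt1R. Qed.

Lemma padic_val_frac (a b : int) : a != 0 -> b != 0 ->
  padic_val (a%:~R / b%:~R) = (logn P `|a|)%:Z - (logn P `|b|)%:Z.
Proof.
move=> a0 b0; set q : rat := _ / _.
have bq0 : b%:~R != 0 :> rat by rewrite intr_eq0.
have q0 : q != 0 by rewrite mulf_neq0 ?invr_eq0 ?intr_eq0.
have E : (numq q * b = a * denq q)%R.
  have: (numq q * b)%:~R = (a * denq q)%:~R :> rat.
    rewrite !intrM -[X in _ = _ * X]mul1r numqE.
    by rewrite /q mul1r mulrAC divfK // mulrAC.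
  by move/intr_inj.
have n0 : (0 < `|numq q|)%N by rewrite absz_gt0 numq_eq0.
have d0 : (0 < `|denq q|)%N by rewrite absz_gt0 denq_neq0.
have a0' : (0 < `|a|)%N by rewrite absz_gt0.
have b0' : (0 < `|b|)%N by rewrite absz_gt0.
have := congr1 (fun z : int => logn P `|z|) E.
rewrite !abszM !lognM // /padic_val; lia.
Qed.

Lemma padic_valM (q r : rat) : q != 0 -> r != 0 ->
  padic_val (q * r) = padic_val q + padic_val r.
Proof.
move=> q0 r0.
have -> : q * r = (numq q * numq r)%:~R / (denq q * denq r)%:~R.
  by rewrite -{1}[q]divq_num_den -{1}[r]divq_num_den mulf_div !intrM.
rewrite padic_val_frac ?mulf_neq0 ?denq_neq0 ?numq_eq0 //.
rewrite !abszM !lognM ?absz_gt0 ?denq_neq0 ?numq_eq0 // /padic_val; lia.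
Qed.

Lemma logn_absD (a b : int) : a + b != 0 -> a != 0 -> b != 0 ->
  (minn (logn P (absz a)) (logn P (absz b)) <= logn P (absz (a + b)%R))%N.
Proof.
move=> ab0 a0 b0; rewrite -pfactor_dvdn ?(valP p) ?absz_gt0 //.
set m := minn _ _.
have H : (((P ^ m)%N)%:Z %| a + b)%Z.
  by apply: rpredD; rewrite dvdzE pfactor_dvdn ?(valP p) ?absz_gt0 // /m;
    rewrite geq_min leqnn ?orbT.
by move: H; rewrite dvdzE.
Qed.

Lemma padic_valD (q r : rat) : q != 0 -> r != 0 -> q + r != 0 ->
  (padic_val q <= padic_val (q + r)) || (padic_val r <= padic_val (q + r)).
Proof.
move=> q0 r0 qr0.
have E : q + r = (numq q * denq r + numq r * denq q)%:~R / (denq q * denq r)%:~R.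
  rewrite -{1}[q]divq_num_den -{1}[r]divq_num_den addf_div ?intr_eq0 ?denq_neq0 //.
  by rewrite !(intrM, intrD).
have s0 : numq q * denq r + numq r * denq q != 0.
  by apply: contraNneq qr0 => e; rewrite E e mul0r.
rewrite E padic_val_frac ?mulf_neq0 ?denq_neq0 //.
have := @logn_absD (numq q * denq r) (numq r * denq q) s0.
rewrite !mulf_neq0 ?denq_neq0 ?numq_eq0 // => /(_ isT isT).
rewrite !abszM !lognM ?absz_gt0 ?denq_neq0 ?numq_eq0 // /padic_val.
set l := logn P (absz (_ + _)).
move: l (logn P `|numq q|) (logn P `|numq r|) (logn P `|denq q|)
  (logn P `|denq r|) => l a b c d; lia.
Qed.

Lemma padic_abs0 : padic_abs 0 = 0.
Proof. by rewrite /padic_abs eqxx. Qed.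

Lemma padic_abs_ge0 q : 0 <= padic_abs q.
Proof.
by rewrite /padic_abs; case: ifP => // _; rewrite exprz_ge0 // ltW // prime_gt0R.
Qed.

Lemma padic_abs_eq0 q : (padic_abs q == 0) = (q == 0).
Proof.
rewrite /padic_abs; case: (eqVneq q 0) => [_|_]; first by rewrite eqxx.
by rewrite expfz_eq0 (gt_eqF prime_gt0R) andbF.
Qed.

Lemma padic_absM q r : padic_abs (q * r) = padic_abs q * padic_abs r.
Proof.
rewrite /padic_abs mulf_eq0.
case: (eqVneq q 0) => [_|q0] /=; first by rewrite mul0r.
case: (eqVneq r 0) => [_|r0] /=; first by rewrite mulr0.
by rewrite padic_valM // opprD expfzDr // gt_eqF // prime_gt0R.
Qed.

Lemma padic_abs1 : padic_abs 1 = 1.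
Proof.
apply: (@mulfI _ (padic_abs 1)); first by rewrite padic_abs_eq0 oner_eq0.
by rewrite -padic_absM !mulr1.
Qed.

Lemma padic_absN q : padic_abs (- q) = padic_abs q.
Proof.
by rewrite /padic_abs oppr_eq0 /padic_val numqN denqN abszN.
Qed.

Lemma padic_abs_distC q r : padic_abs (q - r) = padic_abs (r - q).
Proof. by rewrite -padic_absN opprB. Qed.

Lemma padic_absV q : padic_abs q^-1 = (padic_abs q)^-1.
Proof.
have [->|q0] := eqVneq q 0; first by rewrite invr0 padic_abs0 invr0.
apply: (@mulfI _ (padic_abs q)); first by rewrite padic_abs_eq0.
by rewrite -padic_absM !divff ?padic_abs1 // padic_abs_eq0.
Qed.

Lemma padic_abs_ultra q r :
  padic_abs (q + r) <= Num.max (padic_abs q) (padic_abs r).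
Proof.
have [->|q0] := eqVneq q 0; first by rewrite add0r le_max lexx orbT.
have [->|r0] := eqVneq r 0; first by rewrite addr0 le_max lexx.
have [->|qr0] := eqVneq (q + r) 0; first by rewrite padic_abs0 le_max padic_abs_ge0.
rewrite le_max /padic_abs (negbTE q0) (negbTE r0) (negbTE qr0).
have := padic_valD q0 r0 qr0.
by rewrite !(ler_eXz2l prime_gt1R) !lerN2.
Qed.

Lemma padic_absD q r : padic_abs (q + r) <= padic_abs q + padic_abs r.
Proof.
apply: le_trans (padic_abs_ultra q r) _.
by rewrite ge_max lerDl lerDr !padic_abs_ge0.
Qed.

Lemma padic_abs_dist q r : `|padic_abs q - padic_abs r| <= padic_abs (q - r).
Proof.
have := padic_absD (q - r) r; rewrite subrK => h1.
have := padic_absD (r - q) q; rewrite subrK padic_abs_distC => h2.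
rewrite ler_norml; apply/andP; split; lra.
Qed.

End PadicAbs.

Section PadicField.
Variables (R : realType) (p : prime_nat).
Local Notation abs := (padic_abs R p).

Definition is_padic_cauchy (u : nat -> rat) : Prop :=
  forall e : R, 0 < e -> exists N, forall m n : nat,
    (N <= m)%N -> (N <= n)%N -> abs (u m - u n) < e.

Definition is_padic_null (u : nat -> rat) : Prop :=
  forall e : R, 0 < e -> exists N, forall n : nat, (N <= n)%N -> abs (u n) < e.

Definition padic_cauchy : {pred nat -> rat} := fun u => `[< is_padic_cauchy u >].

Lemma padic_cauchy_bounded u : is_padic_cauchy u ->
  exists M : R, 0 < M /\ exists N, forall n : nat, (N <= n)%N -> abs (u n) < M.
Proof.
move=> /(_ 1 ltr01) [N HN]; exists (abs (u N) + 1).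
split; first by rewrite ltr_wpDl ?padic_abs_ge0.
exists N => n Nn; have := HN n N Nn (leqnn N).
have := padic_absD R p (u n - u N) (u N); rewrite subrK; lra.
Qed.

Fact padic_cauchy_subring : subring_closed padic_cauchy.
Proof.
split=> [|u v /asboolP cu /asboolP cv|u v /asboolP cu /asboolP cv]; apply/asboolP.
- by move=> e e0; exists 0%N => m n _ _; rewrite subrr padic_abs0.
- move=> e e0; have e20 : 0 < e / 2 by rewrite divr_gt0.
  have [N HN] := cu _ e20; have [N' HN'] := cv _ e20.
  exists (maxn N N') => m n; rewrite !geq_max => /andP[m1 m2] /andP[n1 n2].
  have -> : (u - v) m - (u - v) n = (u m - u n) + - (v m - v n).
    by rewrite [LHS](_ : _ = (u m - v m) - (u n - v n)) //; ring.
  apply: le_lt_trans (padic_absD _ _ _ _) _; rewrite padic_absN.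
  by have := HN _ _ m1 n1; have := HN' _ _ m2 n2; lra.
- move=> e e0.
  have [M [M0 [N1 HN1]]] := padic_cauchy_bounded cu.
  have [M' [M'0 [N2 HN2]]] := padic_cauchy_bounded cv.
  have e1 : 0 < e / (2 * M) by rewrite divr_gt0 // mulr_gt0.
  have e2 : 0 < e / (2 * M') by rewrite divr_gt0 // mulr_gt0.
  have [N HN] := cu _ e2; have [N' HN'] := cv _ e1.
  exists (maxn (maxn N1 N2) (maxn N N')) => m n.
  rewrite !geq_max => /andP[/andP[a1 a2] /andP[a3 a4]].
  move=> /andP[/andP[b1 b2] /andP[b3 b4]].
  have -> : (u * v) m - (u * v) n = u m * (v m - v n) + (u m - u n) * v n.
    by rewrite [LHS](_ : _ = u m * v m - u n * v n) //; ring.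
  apply: le_lt_trans (padic_absD _ _ _ _) _; rewrite !padic_absM.
  have -> : e = M * (e / (2 * M)) + e / (2 * M') * M'.
    by field; rewrite !gt_eqF.
  apply: ltr_leD.
    by apply: ltr_pM; rewrite ?padic_abs_ge0 //; [exact: HN1|exact: HN'].
  by apply: ler_pM; rewrite ?padic_abs_ge0 // ltW //; [exact: HN|exact: HN2].
Qed.

HB.instance Definition _ :=
  GRing.isSubringClosed.Build (nat -> rat) padic_cauchy padic_cauchy_subring.

Record cauchy_seq : Type :=
  CauchySeq { cauchy_fun :> nat -> rat; _ : cauchy_fun \in padic_cauchy }.

HB.instance Definition _ := [isSub for cauchy_fun].
HB.instance Definition _ := [Choice of cauchy_seq by <:].
HB.instance Definition _ := [SubChoice_isSubComNzRing of cauchy_seq by <:].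

Definition padic_null : {pred cauchy_seq} := fun u => `[< is_padic_null u >].

Lemma cauchy_seqP (u : cauchy_seq) : is_padic_cauchy u.
Proof. by apply/asboolP; case: u. Qed.

Fact padic_null_ideal : idealr_closed padic_null.
Proof.
split.
- by apply/asboolP => e e0; exists 0%N => n _; rewrite padic_abs0.
- apply/negP => /asboolP /(_ 1 ltr01) [N /(_ N (leqnn N))].
  by rewrite padic_abs1 ltxx.
- move=> a u v /asboolP nu /asboolP nv; apply/asboolP => e e0.
  have [M [M0 [N1 HN1]]] := padic_cauchy_bounded (cauchy_seqP a).
  have e1 : 0 < e / (2 * M) by rewrite divr_gt0 // mulr_gt0.
  have e2 : 0 < e / 2 by rewrite divr_gt0.
  have [N HN] := nu _ e1; have [N' HN'] := nv _ e2.
  exists (maxn N1 (maxn N N')) => n; rewrite !geq_max => /and3P[a1 a2 a3].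
  apply: le_lt_trans (padic_absD _ _ _ _) _; rewrite !padic_absM.
  have -> : e = M * (e / (2 * M)) + e / 2 by field; rewrite gt_eqF.
  apply: ltrD; last exact: HN'.
  by apply: ltr_pM; rewrite ?padic_abs_ge0 //; [exact: HN1|exact: HN].
Qed.

HB.instance Definition _ :=
  isIdealr.Build cauchy_seq padic_null padic_null_ideal.

(* Q_p: Cauchy sequences of rationals for |.|_p modulo null sequences *)
Definition Qp : Type := {ideal_quot padic_null}.
HB.instance Definition _ := GRing.ComNzRing.on Qp.

End PadicField.

Section PadicMetric.
Variables (R : realType) (p : prime_nat).
Local Notation abs := (padic_abs R p).
Local Notation cauchy_seq := (cauchy_seq R p).
Local Notation Qp := (Qp R p).
Local Open Scope quotient_scope.

Definition padic_class (u : cauchy_seq) : Qp :=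
  \pi_({ideal_quot (@padic_null R p)}) u.

Lemma padic_classB : {morph padic_class : u v / u - v}.
Proof. exact: rmorphB. Qed.

Lemma padic_classM : {morph padic_class : u v / u * v}.
Proof. exact: rmorphM. Qed.

Lemma padic_class1 : padic_class 1 = 1.
Proof. exact: rmorph1. Qed.

Definition padic_repr (x : Qp) : cauchy_seq :=
  repr (x : {ideal_quot (@padic_null R p)}).

Lemma padic_reprK : cancel padic_repr padic_class.
Proof. exact: reprK. Qed.

Lemma padic_class_eq (u v : cauchy_seq) :
  padic_class u = padic_class v <-> is_padic_null R p (u - v).
Proof.
split=> [/eqP|h].
  by rewrite /padic_class -Quotient.idealrBE => /asboolP.
by apply/eqP; rewrite /padic_class -Quotient.idealrBE; apply/asboolP.
Qed.

Lemma padic_seq_cvg (u : cauchy_seq) : cvgn (fun n => abs (u n)).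
Proof.
apply/cauchy_cvgP/cauchy_ballP => e e0.
have [N HN] := cauchy_seqP u e0.
pose tail := [set abs (u n) | n in [set n | (N <= n)%N]].
exists (tail, tail); first by split; exists N => // n Nn; exists n.
move=> [_ _] /= [[m Nm <-] [n Nn <-]]; rewrite /ball /=.
exact: le_lt_trans (padic_abs_dist _ _ _ _) (HN _ _ Nm Nn).
Qed.

Definition padic_seq_norm (u : cauchy_seq) : R := limn (fun n => abs (u n)).

Lemma padic_seq_norm_null (u : cauchy_seq) :
  padic_seq_norm u = 0 <-> is_padic_null R p u.
Proof.
split=> [u0 e e0|nu].
  have /cvgrPdist_lt /(_ e e0) [N _ HN] := @padic_seq_cvg u.
  exists N => n /HN /=; rewrite -/(padic_seq_norm u) u0 sub0r normrN.
  by rewrite ger0_norm ?padic_abs_ge0.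
apply/cvg_lim => //; apply/cvgrPdist_lt => e e0.
have [N HN] := nu e e0; exists N => // n /HN /=.
by rewrite sub0r normrN ger0_norm ?padic_abs_ge0.
Qed.

Lemma padic_seq_normD (u v : cauchy_seq) :
  padic_seq_norm (u + v) <= padic_seq_norm u + padic_seq_norm v.
Proof.
rewrite /padic_seq_norm -limD; [|exact: padic_seq_cvg..].
apply: ler_lim; [exact: padic_seq_cvg| |].
  by apply: is_cvgD; exact: padic_seq_cvg.
by apply: nearW => n; exact: padic_absD.
Qed.

Lemma padic_seq_normN (u : cauchy_seq) :
  padic_seq_norm (- u) = padic_seq_norm u.
Proof.
by rewrite /padic_seq_norm; congr (limn _); apply/funext => n; exact: padic_absN.
Qed.

Lemma padic_seq_norm_class (u v : cauchy_seq) :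
  padic_class u = padic_class v -> padic_seq_norm u = padic_seq_norm v.
Proof.
move/padic_class_eq/padic_seq_norm_null => uv0.
have := padic_seq_normD (u - v) v; rewrite subrK uv0.
have := padic_seq_normD (v - u) u; rewrite subrK -opprB padic_seq_normN uv0.
by rewrite !add0r => h1 h2; apply/eqP; rewrite eq_le h1 h2.
Qed.

Definition padic_norm (x : Qp) : R := padic_seq_norm (padic_repr x).

Lemma padic_norm_class u : padic_norm (padic_class u) = padic_seq_norm u.
Proof. by apply: padic_seq_norm_class; rewrite padic_reprK. Qed.

Lemma padic_norm_eq0 x : padic_norm x = 0 -> x = 0.
Proof.
move/padic_seq_norm_null => nx; rewrite -[x]padic_reprK.
rewrite -[RHS](rmorph0 (\pi_({ideal_quot (@padic_null R p)}))).
by apply/padic_class_eq; rewrite subr0.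
Qed.

Lemma padic_norm0 : padic_norm 0 = 0.
Proof.
rewrite -[X in padic_norm X](subrr (padic_class 0)) -padic_classB subrr.
rewrite padic_norm_class; apply/padic_seq_norm_null => e e0.
by exists 0%N => n _; rewrite padic_abs0.
Qed.

Lemma padic_normD x y : padic_norm (x + y) <= padic_norm x + padic_norm y.
Proof.
rewrite -[x]padic_reprK -[y]padic_reprK.
have -> : padic_class (padic_repr x) + padic_class (padic_repr y) =
  padic_class (padic_repr x + padic_repr y) by rewrite /padic_class rmorphD.
by rewrite !padic_norm_class padic_seq_normD.
Qed.

Lemma padic_norm_distC x y : padic_norm (x - y) = padic_norm (y - x).
Proof.
rewrite -[x]padic_reprK -[y]padic_reprK -!padic_classB !padic_norm_class.
by rewrite -padic_seq_normN opprB.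
Qed.

Definition padic_dist (x y : Qp) : R := padic_norm (x - y).

Fact padic_distxx x : padic_dist x x = 0.
Proof. by rewrite /padic_dist subrr padic_norm0. Qed.

Fact padic_dist_eq0 x y : padic_dist x y = 0 -> x = y.
Proof. by move/padic_norm_eq0/eqP; rewrite subr_eq0 => /eqP. Qed.

Fact padic_distC x y : padic_dist x y = padic_dist y x.
Proof. exact: padic_norm_distC. Qed.

Fact padic_dist_triangle y x z :
  padic_dist x z <= padic_dist x y + padic_dist y z.
Proof. by apply: le_trans (padic_normD _ _); rewrite subrKA. Qed.

HB.instance Definition _ := isMetric.Build R Qp
  padic_distxx padic_dist_eq0 padic_distC padic_dist_triangle.

Lemma padic_inverse (x : Qp) : x != 0 -> exists y : Qp, y * x = 1.
Proof.
move=> x0; have n0 : padic_norm x != 0.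
  by apply: contra_neq x0; exact: padic_norm_eq0.
pose u := padic_repr x.
have lge0 : 0 <= padic_norm x.
  apply: limr_ge; first exact: padic_seq_cvg.
  by apply: nearW => n; exact: padic_abs_ge0.
pose d := padic_norm x / 2.
have d0 : 0 < d by rewrite divr_gt0 // lt_neqAle eq_sym n0.
have [N0 HN0] : exists N, forall n, (N <= n)%N -> d < abs (u n).
  have /cvgrPdist_lt /(_ d d0) [N _ HN] := @padic_seq_cvg u.
  exists N => n /HN /=; rewrite -/(padic_seq_norm u) -/(padic_norm x).
  by move=> /ltr_normlP[_]; rewrite /d; lra.
have u0 n : (N0 <= n)%N -> u n != 0.
  by move=> /HN0 h; rewrite -(padic_abs_eq0 R p) gt_eqF // (lt_trans d0).
have cv : (fun n => (u n)^-1) \in padic_cauchy R p.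
  apply/asboolP => e e0.
  have ed : 0 < e * (d * d) by rewrite mulr_gt0 // mulr_gt0.
  have [N HN] := cauchy_seqP u ed; exists (maxn N0 N) => m n.
  rewrite !geq_max => /andP[m1 m2] /andP[n1 n2].
  have -> : (u m)^-1 - (u n)^-1 = (u n - u m) / (u m * u n).
    by field; rewrite (u0 _ m1) (u0 _ n1).
  rewrite padic_absM padic_absV padic_absM ltr_pdivrMr; last first.
    by rewrite mulr_gt0 // (lt_trans d0) // HN0.
  apply: lt_le_trans (HN _ _ n2 m2) _; rewrite ler_pM2l //.
  by rewrite ler_pM // ltW // HN0.
exists (padic_class (CauchySeq cv)).
rewrite -[X in _ * X]padic_reprK -padic_classM -padic_class1; apply/padic_class_eq.
move=> e e0; exists N0 => n /u0 un0.
rewrite [X in abs X](_ : _ = (u n)^-1 * u n - 1) //.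
by rewrite mulVf // subrr padic_abs0.
Qed.

Definition padic_inv (x : Qp) : Qp := xget 0 [set y | y * x = 1].

Fact padic_mulVf (x : Qp) : x != 0 -> padic_inv x * x = 1.
Proof. by move=> /padic_inverse xV; exact: (xgetPex 0 xV). Qed.

Fact padic_inv0 : padic_inv 0 = 0.
Proof.
rewrite /padic_inv; case: xgetP => // y _ /= /eqP.
by rewrite mulr0 eq_sym oner_eq0.
Qed.

HB.instance Definition _ := GRing.ComNzRing_isField.Build Qp padic_mulVf padic_inv0.

Definition padic_const (q : rat) : nat -> rat := fun=> q.

Fact padic_const_cauchy q : padic_const q \in padic_cauchy R p.
Proof.
by apply/asboolP => e e0; exists 0%N => m n _ _; rewrite subrr padic_abs0.
Qed.

Definition padic_of_rat (q : rat) : Qp :=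
  padic_class (CauchySeq (padic_const_cauchy q)).

Fact padic_of_rat_zmod : zmod_morphism padic_of_rat.
Proof.
by move=> q r; rewrite /padic_of_rat -padic_classB; congr padic_class; exact: val_inj.
Qed.

Fact padic_of_rat_monoid : monoid_morphism padic_of_rat.
Proof.
split=> [|q r]; rewrite /padic_of_rat; last first.
  by rewrite -padic_classM; congr padic_class; exact: val_inj.
by rewrite -padic_class1; congr padic_class; exact: val_inj.
Qed.

HB.instance Definition _ :=
  GRing.isZmodMorphism.Build rat Qp padic_of_rat padic_of_rat_zmod.
HB.instance Definition _ :=
  GRing.isMonoidMorphism.Build rat Qp padic_of_rat padic_of_rat_monoid.

Lemma padic_norm_rat q : padic_norm (padic_of_rat q) = abs q.
Proof. by rewrite padic_norm_class; apply: lim_near_cst => //; exact: nearW. Qed.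

End PadicMetric.

Section QuotientSpace.
Local Open Scope quotient_scope.
Variables (X : topologicalType) (r : X -> X -> Prop).
Hypothesis r_equiv : equivalence X r.

Let r_rel : rel X := fun x y => `[< r x y >].

Fact quot_space_equiv : equiv_class_of r_rel.
Proof.
case: r_equiv => rr rt rs; split.
- by move=> x; apply/asboolP; exact: rr.
- by move=> x y; apply/asboolP/asboolP; exact: rs.
- by move=> y x z /asboolP xy /asboolP yz; apply/asboolP; exact: rt xy yz.
Qed.

Definition quot_space : topologicalType :=
  quotient_topology {eq_quot (EquivRelPack quot_space_equiv)}.

Definition quot_map (x : X) : quot_space :=
  (\pi_({eq_quot (EquivRelPack quot_space_equiv)}) x).

Definition quot_repr (y : quot_space) : X :=
  repr (y : {eq_quot (EquivRelPack quot_space_equiv)}).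

Lemma quot_reprK : cancel quot_repr quot_map.
Proof. exact: reprK. Qed.

Lemma quot_mapP (x y : X) : quot_map x = quot_map y <-> r x y.
Proof.
split=> [/eqmodP/asboolP //|rxy].
by apply/eqmodP/asboolP.
Qed.

Lemma quot_map_continuous : continuous quot_map.
Proof. exact: pi_continuous. Qed.

End QuotientSpace.

Definition homeomorphism_on (X Y : topologicalType) (A : set X) (B : set Y)
    (f : X -> Y) (g : Y -> X) : Prop :=
  [/\ {homo f : x / A x >-> B x}, {homo g : y / B y >-> A y},
      {in A, cancel f g} /\ {in B, cancel g f},
      {within A, continuous f} & {within B, continuous g}].

Definition is_homeomorphism (X Y : topologicalType) (f : X -> Y) : Prop :=
  exists g : Y -> X, homeomorphism_on setT setT f g.

Definition open_cover (X : topologicalType) (U : set (set X)) : Prop :=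
  (forall A, U A -> open A) /\ \bigcup_(A in U) A = setT.

(* Every open cover has an open refinement in which each point lies in at most
   m members, i.e. X has Lebesgue covering dimension <= m - 1. *)
Definition refinable (X : topologicalType) (m : nat) : Prop :=
  forall U : set (set X), open_cover U ->
  exists V : set (set X), [/\ open_cover V,
    forall B, V B -> exists2 A, U A & B `<=` A &
    forall x, ([set B | V B /\ B x] #<= `I_m)%card].

Definition has_covering_dim (X : topologicalType) (d : nat) : Prop :=
  refinable X d.+1 /\ ~ refinable X d.

(* Charts are onto (open ball of R^n) x T; the transverse coordinate of a
   change of charts depends, locally, only on the transverse coordinate. *)
Record lamination (R : realType) (n : nat) (X : topologicalType) := Lamination {
  chart_index : Type;
  transversal : chart_index -> topologicalType;
  chart_dom : chart_index -> set X;
  chart_ball : chart_index -> set 'rV[R]_n;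
  chart : forall i, X -> 'rV[R]_n * transversal i;
  chart_inv : forall i, 'rV[R]_n * transversal i -> X;
  chart_dom_open : forall i, open (chart_dom i);
  chart_dom_cover : \bigcup_i chart_dom i = setT;
  chart_ballP : forall i, exists c (e : R), 0 < e /\ chart_ball i = ball c e;
  chart_homeo : forall i, homeomorphism_on
    (chart_dom i) (chart_ball i `*` setT) (chart i) (@chart_inv i);
  chart_change : forall i j x, chart_dom i x -> chart_dom j x ->
    exists V (h : transversal i -> transversal j),
      [/\ open V, V x, V `<=` chart_dom i `&` chart_dom j &
          forall y, V y -> (chart j y).2 = h (chart i y).2]
}.

Section LaminationTheory.
Variables (R : realType) (n : nat) (X : topologicalType).
Variable L : lamination R n X.

Definition same_plaque (x y : X) : Prop :=
  exists i : chart_index L,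
    [/\ chart_dom i x, chart_dom i y & (chart i x).2 = (chart i y).2].

Definition same_leaf : X -> X -> Prop := clos_refl_sym_trans X same_plaque.

Definition leaf_space : topologicalType :=
  quot_space (clos_rst_is_equiv X same_plaque).

Definition leaf_map : X -> leaf_space := quot_map (clos_rst_is_equiv X same_plaque).

Definition has_codim (d : nat) : Prop :=
  forall i : chart_index L, has_covering_dim (transversal i) d.

(* The leaves are the orbits of act, and in each chart act is the translation
   of the R^n-coordinate, as long as this stays within the chart. *)
Definition defined_by_action (act : 'rV[R]_n -> X -> X) : Prop :=
  (forall x y, same_leaf x y <-> exists v, y = act v x) /\
  (forall (i : chart_index L) x v, chart_dom i x ->
     chart_ball i ((chart i x).1 + v) ->
     chart_dom i (act v x) /\
     chart i (act v x) = ((chart i x).1 + v, (chart i x).2)).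

End LaminationTheory.

(* None is the archimedean place, Some p is the place of the prime p. *)
Notation place := (option prime_nat).

Definition Qv (R : realType) (v : place) : topologicalType :=
  if v is Some p then Qp R p else R.

Definition Qv_scale (R : realType) (q : rat) (v : place) : Qv R v -> Qv R v :=
  match v with
  | None => fun x : R => ratr q * x
  | Some p => fun x : Qp R p => ratr q * x
  end.

Lemma ratr_Qp (R : realType) (p : prime_nat) (q : rat) :
  ratr q = padic_of_rat R p q.
Proof. by rewrite (fmorph_eq_rat (padic_of_rat R p)). Qed.

Lemma Qv_scale1 (R : realType) v (x : Qv R v) : Qv_scale 1 x = x.
Proof.
by case: v x => [p|] x /=; rewrite ?ratr_Qp rmorph1 mul1r.
Qed.

Lemma Qv_scaleM (R : realType) q r v (x : Qv R v) :
  Qv_scale (q * r) x = Qv_scale q (Qv_scale r x).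
Proof.
by case: v x => [p|] x /=; rewrite ?ratr_Qp rmorphM mulrA.
Qed.

Section Adeles.
Variables (R : realType) (S : {fset place}).

(* A_S, the product of the completions at the places in S *)
Definition adeles : topologicalType := prod_topology (fun v : S => Qv R (val v)).

Definition adele_scale (q : rat) (a : adeles) : adeles :=
  fun v : S => Qv_scale q (a v).

Lemma adele_scale1 a : adele_scale 1 a = a.
Proof. by apply: functional_extensionality_dep => v; exact: Qv_scale1. Qed.

Lemma adele_scaleM q r a :
  adele_scale (q * r) a = adele_scale q (adele_scale r a).
Proof. by apply: functional_extensionality_dep => v; exact: Qv_scaleM. Qed.

Definition fin_rank : nat := #|` S|.-1.

Definition finite_places : seq prime_nat := pmap id S.

Lemma size_finite_places : None \in S -> size finite_places = fin_rank.
Proof.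
move=> S0; rewrite /finite_places /fin_rank size_pmap.
rewrite -(count_predC (pred1 (None : place)) S) count_uniq_mem ?fset_uniq // S0.
by rewrite add1n /=; apply: eq_count; case.
Qed.

(* p_1, ..., p_n; the default value 2 is not reached when S contains None *)
Definition place_prime (j : 'I_fin_rank) : nat :=
  sval (nth (exist _ 2%N isT : prime_nat) finite_places j).

(* (b, k) stands for (-1)^b p_1^(k_1) ... p_n^(k_n) *)
Definition Gamma : Type := (bool * 'rV[int]_fin_rank)%type.

Definition Gamma_val (g : Gamma) : rat :=
  (-1) ^+ g.1 * \prod_(j < fin_rank) (place_prime j)%:R ^ (g.2 ord0 j).

Definition Gamma_mul (g h : Gamma) : Gamma := (g.1 (+) h.1, g.2 + h.2).

Definition Gamma_inv (g : Gamma) : Gamma := (g.1, - g.2).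

Lemma Gamma_val1 : Gamma_val (false, 0) = 1.
Proof.
rewrite /Gamma_val /= expr0 mul1r big1 // => j _.
by rewrite mxE expr0z.
Qed.

Lemma Gamma_valM g h : Gamma_val (Gamma_mul g h) = Gamma_val g * Gamma_val h.
Proof.
rewrite /Gamma_val /= signr_addb mulrACA -big_split /=; congr (_ * _).
apply: eq_bigr => j _; rewrite mxE expfzDr // pnatr_eq0 -lt0n.
by rewrite prime_gt0 // (svalP (nth _ finite_places j)).
Qed.

Lemma Gamma_mulV g : Gamma_mul (Gamma_inv g) g = (false, 0).
Proof. by rewrite /Gamma_mul /= addbb addNr. Qed.

Definition Gamma_translation (g : Gamma) : 'rV[R]_fin_rank := map_mx intr g.2.

Lemma Gamma_translationM g h :
  Gamma_translation (Gamma_mul g h) = Gamma_translation g + Gamma_translation h.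
Proof. by apply/rowP => j; rewrite !mxE rmorphD. Qed.

Lemma Gamma_translation1 : Gamma_translation (false, 0) = 0.
Proof. by apply/rowP => j; rewrite !mxE. Qed.

Definition quotient_rel (a b : adeles) : Prop :=
  exists g : Gamma, b = adele_scale (Gamma_val g) a.

Fact quotient_rel_equiv : equivalence adeles quotient_rel.
Proof.
split.
- by move=> a; exists (false, 0); rewrite Gamma_val1 adele_scale1.
- move=> a _ _ [g ->] [h ->]; exists (Gamma_mul h g).
  by rewrite Gamma_valM adele_scaleM.
- move=> a _ [g ->]; exists (Gamma_inv g).
  by rewrite -adele_scaleM -Gamma_valM Gamma_mulV Gamma_val1 adele_scale1.
Qed.

(* Gamma \ A_S *)
Definition adele_quotient : topologicalType := quot_space quotient_rel_equiv.

Definition adele_quotient_map : adeles -> adele_quotient :=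
  quot_map quotient_rel_equiv.

Definition Gamma_act (g : Gamma) (x : adeles * 'rV[R]_fin_rank) :
    adeles * 'rV[R]_fin_rank :=
  (adele_scale (Gamma_val g) x.1, x.2 + Gamma_translation g).

Definition hquotient_rel (x y : adeles * 'rV[R]_fin_rank) : Prop :=
  exists g : Gamma, y = Gamma_act g x.

Lemma Gamma_act1 x : Gamma_act (false, 0) x = x.
Proof.
case: x => a t; rewrite /Gamma_act Gamma_val1 adele_scale1.
by rewrite Gamma_translation1 addr0.
Qed.

Lemma Gamma_actM g h x : Gamma_act (Gamma_mul g h) x = Gamma_act g (Gamma_act h x).
Proof.
rewrite /Gamma_act Gamma_valM adele_scaleM Gamma_translationM -addrA.
by congr (_, _ + _); exact: addrC.
Qed.

Fact hquotient_rel_equiv : equivalence (adeles * 'rV[R]_fin_rank) hquotient_rel.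
Proof.
split.
- by move=> x; exists (false, 0); rewrite Gamma_act1.
- by move=> x _ _ [g ->] [h ->]; exists (Gamma_mul h g); rewrite Gamma_actM.
- move=> x _ [g ->]; exists (Gamma_inv g).
  by rewrite -Gamma_actM Gamma_mulV Gamma_act1.
Qed.

(* Gamma \ (A_S x R^n) *)
Definition adele_hquotient : topologicalType := quot_space hquotient_rel_equiv.

Definition adele_hquotient_map : adeles * 'rV[R]_fin_rank -> adele_hquotient :=
  quot_map hquotient_rel_equiv.

(* (a, t) |-> (a, t + v) on classes, cf. translate_map *)
Definition translate (v : 'rV[R]_fin_rank) (y : adele_hquotient) :
    adele_hquotient :=
  adele_hquotient_map ((quot_repr y).1, (quot_repr y).2 + v).

Lemma translate_map v a t :
  translate v (adele_hquotient_map (a, t)) = adele_hquotient_map (a, t + v).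
Proof.
rewrite /translate; apply/quot_mapP.
have /quot_mapP [g] := quot_reprK (adele_hquotient_map (a, t)).
case: (quot_repr _) => b s [-> ->]; exists g.
by congr (_, _); rewrite addrAC.
Qed.

End Adeles.

(* Main.v *)
Require Import Defs.
From Stdlib Require Import Relations.
From mathcomp Require Import all_boot all_order all_algebra finmap.
From mathcomp Require Import all_classical all_reals all_analysis.
From mathcomp Require Import ring lra zify.

Set Implicit Arguments.
Unset Strict Implicit.
Unset Printing Implicit Defensive.

Import Order.TTheory GRing.Theory Num.Theory.
Import numFieldNormedType.Exports.

Local Open Scope classical_set_scope.
Local Open Scope ring_scope.

(** Let X be A_S x R^n.  The group Gamma acts on X through homeomorphisms, and
    properly: an element is determined up to sign by its translation part, which
    is integral, so at most two elements move a small ball of R^n to a set that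
    meets another one.  A quotient by a proper action inherits separation and compact
    neighbourhoods ([quot_hausdorff], [quot_compact_nbhs]); upstairs these come
    from the Hausdorff and locally compact factors R and Q_p, the latter by
    completeness and total boundedness of the balls ([padic_ball_compact]).

    Upper bounds for the dimension.  If a space is the union of m subsets Z, each
    of which has a countable family of open sets whose boundaries avoid Z and
    that contains arbitrarily small neighbourhoods of the points of Z, then every
    open cover has a refinement made of m disjoint families
    ([zero_dim_refinable]).  Points of X have n + 1 real coordinates.  Choose
    n + 2 real numbers alpha_i such that the countable dense sets
    E_i = Q^* alpha_i + Q are disjoint, and let Z_i be the set of points none of
    whose real coordinates lies in E_i.  Boxes with end points in E_i have
    boundaries that avoid Z_i, the balls of Q_p have no boundary at all, and the
    Z_i cover X by the pigeonhole principle ([avoid_pigeonhole]).  They are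
    Gamma-invariant, because E_i is stable under nonzero rational factors and
    under rational translations, so all this descends to the quotient
    ([quot_zero_dim]).

    Lower bounds.  A map f from the cube [0, 1]^d to a Hausdorff space X such
    that images of opposite facets are disjoint prevents X from having dimension
    less than d ([cube_not_refinable]).  This is Lebesgue's covering theorem;
    it is reduced to Sperner's lemma for colourings of a cubical grid
    ([kuhn_cell]), which is proved by a Stokes formula for cochains: the sum of
    the cochain [rainbow] over a triangulated cube is, up to sign, its sum over a
    facet.  The cubes used are formed by the real adeles in [1, 2] and the
    translations in [0, 1/2]^n.

    The lamination.  Over a ball of radius 1/4 of R^n, two points of X are
    identified exactly when they differ by a sign of the adele, so this part of
    the quotient is the product of the ball with A_S / {+1, -1}, which is
    a transversal of dimension 1 by the same two arguments.  On overlaps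
    the transverse coordinate changes by an element of Gamma that is locally
    constant.  Translations decompose into small ones, which stay in a chart, so
    the leaves are the orbits of R^n; forgetting the translation coordinate
    then identifies the leaf space with the quotient of A_S by Gamma. *)

(** * Cochains on ordered tuples and Sperner's lemma on a cubical grid *)

Section Cochains.
Variable T : eqType.
Implicit Types (chi : T -> int) (f g : seq T -> int) (l : seq T).

(** The exterior product of the 0-cochain [chi] with the cochain [f]: on
    [v_0; ...; v_m] it is the alternating sum of [chi v_i * f] over the
    omissions of one vertex.  For [chi = 1] it is the simplicial coboundary. *)
Fixpoint wedge chi f l : int :=
  if l is v :: m then chi v * f m - wedge chi (fun m' => f (v :: m')) m else 0.

Definition coboundary := wedge (fun=> 1).

Lemma wedge_neq0 chi f l : wedge chi f l != 0 ->
  exists v l', [/\ v \in l, chi v != 0, {subset l' <= l} & f l' != 0].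
Proof.
elim: l f => [|v l IH] f /=; first by [].  
have [->|fv] := eqVneq (chi v * f l) 0.
  rewrite sub0r oppr_eq0 => /IH [w [l' [wl cw sl fl]]].
  exists w, (v :: l'); split=> //; first by rewrite inE wl orbT.
  by move=> x; rewrite !inE => /predU1P[->|/sl ->]; rewrite ?eqxx ?orbT.
move=> _; move: fv; rewrite mulf_eq0 => /norP[cv fl].
by exists v, l; split=> //; [exact: mem_head|move=> x xl; rewrite inE xl orbT].
Qed.

Lemma eq_wedge chi chi' f g l : {in l, chi =1 chi'} -> f =1 g ->
  wedge chi f l = wedge chi' g l.
Proof.
elim: l f g => //= v l IH f g E fg; rewrite fg (E v) ?mem_head //.
by congr (_ - _); apply: IH => // x xl; apply: E; rewrite inE xl orbT.
Qed.

Lemma wedgeB chi f g l :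
  wedge chi (fun m => f m - g m) l = wedge chi f l - wedge chi g l.
Proof. by elim: l f g => [|v l IH] f g /=; rewrite ?subrr // IH; ring. Qed.

Lemma wedgeMl chi (a : int) f l :
  wedge chi (fun m => a * f m) l = a * wedge chi f l.
Proof. by elim: l f => [|v l IH] f /=; rewrite ?mulr0 // IH; ring. Qed.

Lemma wedgeDl chi chi' f l :
  wedge (fun v => chi v + chi' v) f l = wedge chi f l + wedge chi' f l.
Proof. by elim: l f => [|v l IH] f /=; rewrite ?addr0 // IH; ring. Qed.

Lemma wedge_suml n (chi : nat -> T -> int) f l :
  wedge (fun v => \sum_(j < n) chi j v) f l = \sum_(j < n) wedge (chi j) f l.
Proof.
elim: n => [|n IH].
  rewrite big_ord0; elim: l f => //= v l IH f.
  by rewrite big_ord0 mul0r IH subr0.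
rewrite big_ord_recr /= -IH -wedgeDl; apply: eq_wedge => // v _.
by rewrite big_ord_recr.
Qed.

Lemma wedgeC chi chi' f l :
  wedge chi (wedge chi' f) l = - wedge chi' (wedge chi f) l.
Proof.
elim: l f => [|v l IH] f /=; first by rewrite oppr0.
by rewrite !wedgeB !wedgeMl IH; ring.
Qed.

Lemma wedgexx chi f l : wedge chi (wedge chi f) l = 0.
Proof.
by have /eqP := wedgeC chi chi f l; rewrite -addr_eq0 -mulr2n mulrn_eq0 => /eqP.
Qed.

(** The determinant-like cochain of a colouring: nonzero only on tuples on
    which all the colours below [n] occur. *)
Fixpoint rainbow (c : T -> nat) n : seq T -> int :=
  if n is n'.+1 then wedge (fun v => (c v == n')%:R) (rainbow c n') else fun=> 1.

Lemma rainbow_neq0 c n l j : rainbow c n l != 0 -> (j < n)%N ->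
  exists2 v, v \in l & c v = j.
Proof.
elim: n l => //= n IH l /wedge_neq0 [v [l' [vl cv sl fl]]].
rewrite ltnS leq_eqVlt => /predU1P[->|jn].
  by exists v => //; apply: contraNeq cv => /negbTE ->.
by have [w /sl wl <-] := IH _ fl jn; exists w.
Qed.

Lemma wedge_rainbow c n l j : (j < n)%N ->
  wedge (fun v => (c v == j)%:R) (rainbow c n) l = 0.
Proof.
elim: n l => //= n IH l; rewrite ltnS leq_eqVlt => /predU1P[->|jn].
  exact: wedgexx.
rewrite wedgeC (@eq_wedge _ (fun v => (c v == n)%:R) _ (fun=> 0 * 0)) //.
  by rewrite wedgeMl mul0r oppr0.
by move=> m; rewrite mul0r; exact: IH.
Qed.

(** When only the colours [0, ..., n] occur, the constant function 1 is the sum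
    of the indicators of the colours; wedging [rainbow c n] with an indicator
    already used gives 0, so only the new colour [n] survives. *)
Lemma coboundary_rainbow c n l : {in l, forall v, (c v <= n)%N} ->
  coboundary (rainbow c n) l = rainbow c n.+1 l.
Proof.
move=> cl; rewrite /coboundary.
rewrite (@eq_wedge _ (fun v => \sum_(j < n.+1) (c v == j)%:R) _ (rainbow c n)) //.
  rewrite (wedge_suml _ (fun j v => (c v == j)%:R)) big_ord_recr /= big1 ?add0r //.
  by move=> j _; exact: wedge_rainbow.
move=> v /cl cv; rewrite (bigD1 (inord (c v))) //= inordK // eqxx big1 ?addr0 //.
move=> j jv; apply/eqP; rewrite pnatr_eq0 eqb0; apply: contraNN jv => /eqP cj.
by apply/eqP/val_inj; rewrite /= inordK cj.
Qed.

End Cochains.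

Lemma wedge_map (T U : eqType) (h : T -> U) chi (f : seq U -> int) l :
  wedge chi f (map h l) = wedge (chi \o h) (f \o map h) l.
Proof. by elim: l f => //= v l IH f; rewrite IH. Qed.

Lemma rainbow_map (T U : eqType) (h : T -> U) c n l :
  rainbow c n (map h l) = rainbow (c \o h) n l.
Proof.
by elim: n l => //= n IH l; rewrite wedge_map; apply: eq_wedge => // m; exact: IH.
Qed.

Section Prism.
Variables (T U : eqType) (lo hi : T -> U).
Implicit Types (f g : seq U -> int) (l : seq T).

(** Evaluation of a cochain on the standard triangulation of the prism
    spanned between the images of a tuple under [lo] and under [hi]. *)
Fixpoint prism f l : int :=
  if l is v :: m then
    f (lo v :: hi v :: map hi m) - prism (fun m' => f (lo v :: m')) m
  else 0.

Lemma eq_prism f g : f =1 g -> prism f =1 prism g.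
Proof.
move=> fg l; elim: l f g fg => //= v l IH f g fg; rewrite fg; congr (_ - _).
by apply: IH => m; exact: fg.
Qed.

Lemma prismB f g l : prism (fun m => f m - g m) l = prism f l - prism g l.
Proof. by elim: l f g => [|v l IH] f g /=; rewrite ?subrr // IH; ring. Qed.

Lemma prism_neq0 f l : prism f l != 0 -> exists l' : seq U,
  [/\ f l' != 0 & {in l', forall y, exists2 x, x \in l & y = lo x \/ y = hi x}].
Proof.
elim: l f => [|v l IH] f /=; first by [].  
have [->|fl _] := eqVneq (f [:: lo v, hi v & map hi l]) 0.
  rewrite sub0r oppr_eq0 => /IH [l' [fl H]]; exists (lo v :: l'); split=> // y.
  rewrite inE => /predU1P[->|/H[x xl Hx]]; first by exists v; [exact: mem_head|left].
  by exists x => //; rewrite inE xl orbT.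
exists [:: lo v, hi v & map hi l]; split=> // y; rewrite !inE.
move=> /or3P[/eqP->|/eqP->|/mapP[x xl ->]].
- by exists v; [exact: mem_head|left].
- by exists v; [exact: mem_head|right].
- by exists x; [rewrite inE xl orbT|right].
Qed.

(** The prism operator is a chain homotopy between the two ends; applied to
    consecutive layers of a grid, it makes Stokes' formula telescope. *)
Lemma prism_coboundary f l : prism (coboundary f) l =
  f (map hi l) - f (map lo l) - coboundary (prism f) l.
Proof.
apply/eqP; rewrite -subr_eq opprK; apply/eqP.
rewrite /coboundary; elim: l f => [|v l IH] f /=; first by ring.
rewrite prismB wedgeB /= !mul1r.
have := IH (fun m => f (lo v :: m)).
have := wedge_map hi (fun=> 1) (fun m => f [:: lo v, hi v & m]) l.
rewrite (@eq_prism (fun m => 1 * f m) f); last by move=> m; rewrite mul1r.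
move=> -> /=; rewrite -[(fun=> 1) \o hi]/(fun=> 1). 
rewrite -[_ \o map hi]/(fun m => f [:: lo v, hi v & map hi m]) => E1.
rewrite -[X in _ = _ - X](subKr (f (lo v :: map hi l))) -E1; ring.
Qed.

End Prism.

Section Grid.
Variable k : nat.
Implicit Types (x b : seq nat) (l : seq (seq nat)) (f g : seq (seq nat) -> int).

Definition slab (s : nat) := prism (cons s) (cons s.+1).

(** The sum of a cochain over the simplices of a triangulation of the cube
    [0, k]^d, built one coordinate at a time from prisms; a point is the
    list of its coordinates, the last one coming first. *)
Fixpoint gridsum d f : int :=
  if d is d'.+1 then \sum_(s < k) gridsum d' (slab s f)
  else f [:: [::]].

Definition in_grid d x := (size x == d) && all (leq^~ k) x.

Definition in_cell b x := all2 (fun i j => (i <= j <= i.+1)%N) b x.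

Lemma in_cell_grid d b x : size b = d -> all (ltn^~ k) b -> in_cell b x ->
  in_grid d x.
Proof.
move=> <-; rewrite /in_grid /in_cell; elim: b x => [|i b IH] [|j x] //=.
case/andP=> ik bk /andP[/andP[ij ji] bx].
have /andP[/eqP -> ->] := IH _ bk bx; rewrite eqxx andbT /=.
exact: leq_trans ji ik.
Qed.

Lemma eq_gridsum d f g : f =1 g -> gridsum d f = gridsum d g.
Proof.
elim: d f g => //= d IH f g fg; apply: eq_bigr => s _; apply: IH.
exact: eq_prism.
Qed.

Lemma gridsumB d f g : gridsum d (fun m => f m - g m) = gridsum d f - gridsum d g.
Proof.
elim: d f g => //= d IH f g; rewrite -sumrB; apply: eq_bigr => s _.
by rewrite -IH; apply: eq_gridsum => m; rewrite /slab prismB.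
Qed.

Lemma gridsum_neq0 d f : gridsum d f != 0 -> exists b l,
  [/\ size b = d, all (ltn^~ k) b, all (in_cell b) l & f l != 0].
Proof.
elim: d f => [|d IH] f /= fd; first by exists [::], [:: [::]].
have [s sf] : exists s : 'I_k, gridsum d (slab s f) != 0.
  apply/existsP; apply: contraNT fd; rewrite negb_exists => /forallP H.
  by rewrite big1 // => s _; apply/eqP; rewrite -[_ == _]negbK H.
have [b [l [bd bk bl]]] := IH _ sf => /prism_neq0 [l' [fl H]].
exists ((s : nat) :: b), l'; split=> //=; [by rewrite bd|by rewrite ltn_ord|].
apply/allP => y /H[x /(allP bl) bx []->] /=.
  by rewrite leqnn leqnSn.
by rewrite leqnSn leqnn.
Qed.

Lemma gridsum_eq0 d f : (forall l, all (in_grid d) l -> f l = 0) -> gridsum d f = 0.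
Proof.
move=> H; apply/eqP/negPn/negP => /gridsum_neq0 [b [l [bd bk bl /eqP]]]; apply.
by apply: H; apply: sub_all bl => x; exact: in_cell_grid.
Qed.

Lemma gridsum_coboundaryS d f : gridsum d.+1 (coboundary f) =
  gridsum d (f \o map (cons k)) - gridsum d (f \o map (cons 0%N))
  - \sum_(s < k) gridsum d (coboundary (slab s f)).
Proof.
rewrite /= -(telescope_sumr (fun s => gridsum d (f \o map (cons s)))) //.
rewrite big_mkord -sumrB; apply: eq_bigr => s _; rewrite -!gridsumB.
by apply: eq_gridsum => l; rewrite /slab prism_coboundary.
Qed.

(** Stokes' formula for cochains that vanish on the boundary of the cube. *)
Lemma gridsum_coboundary d f : f [::] = 0 ->
  (forall i e l, (i < d)%N -> (e == 0)%N || (e == k) -> all (in_grid d) l ->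
     {in l, forall x, nth 0%N x i = e} -> f l = 0) ->
  gridsum d (coboundary f) = 0.
Proof.
elim: d f => [|d IH] f f0 H; first by rewrite /= /coboundary /= f0 mulr0 subr0.
have face e : (e == 0)%N || (e == k) -> gridsum d (f \o map (cons e)) = 0.
  move=> ek; apply: gridsum_eq0 => l dl /=.
  apply: (H 0%N e) => //; last by move=> _ /mapP[x _ ->].
  rewrite all_map; apply: sub_all dl => x /= /andP[/eqP <- xk].
  by rewrite /in_grid /= eqxx xk andbT; case/orP: ek => /eqP ->; rewrite ?leq0n ?leqnn.
rewrite gridsum_coboundaryS !face ?eqxx ?orbT // subrr sub0r big1 ?oppr0 // => s _.
apply: IH => // i e l id ek dl le; apply/eqP/negPn/negP => /prism_neq0 [l' [/eqP fl' H']].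
apply: fl'; apply: (H i.+1 e) => //.
  apply/allP => y /H'[x /(allP dl) /andP[/eqP xd xk] [] ->]; rewrite /in_grid /= xd eqxx xk /= andbT //.
  exact: ltnW.
by move=> y /H'[x /le xe [] ->].
Qed.

(** Position [i] of a point holds the coordinate of index [j = d - i.+1]: the
    colour is at most [j] on the facet x_j = 0 and is not [j] on the facet
    x_j = k. *)
Definition kuhn_coloring d (c : seq nat -> nat) := forall x, in_grid d x ->
  (c x <= d)%N /\ forall i, (i < d)%N ->
    (nth 0%N x i = 0%N -> (c x < d - i)%N) /\ (nth 0%N x i = k -> c x <> (d - i.+1)%N).

(** In dimension d + 1 the cochain [rainbow c d.+2] is the coboundary of
    [rainbow c d.+1].  By Stokes only the facet x_d = 0 contributes to its sum,
    because every other facet misses one of the colours 0, ..., d; this is the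
    induction on the dimension. *)
Lemma gridsum_rainbow d c : kuhn_coloring d c -> gridsum d (rainbow c d.+1) != 0.
Proof.
elim: d c => [|d IH] c cK.
  have [+ _] := cK [::] isT; rewrite leqn0 => /eqP c0.
  by rewrite /= c0 eqxx.
have -> : gridsum d.+1 (rainbow c d.+2) = gridsum d.+1 (coboundary (rainbow c d.+1)).
  apply/eqP; rewrite -subr_eq0 -gridsumB; apply/eqP/gridsum_eq0 => l dl.
  by rewrite coboundary_rainbow ?subrr // => v /(allP dl) /cK[].
rewrite gridsum_coboundaryS.
have -> : gridsum d (rainbow c d.+1 \o map (cons k)) = 0.
  apply: gridsum_eq0 => l dl; apply/eqP/negPn/negP => rl.
  have := rainbow_neq0 rl (ltnSn d).
  case=> _ /mapP[x /(allP dl) /andP[xd xk] ->].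
  have [|_ /(_ 0%N isT) [_ /(_ erefl)]] := cK (k :: x); last by rewrite subn1.
  by rewrite /in_grid /= leqnn eqSS xd xk.
rewrite big1 ?subr0 ?sub0r ?oppr_eq0.
  rewrite (@eq_gridsum _ _ (rainbow (c \o cons 0%N) d.+1)).
    apply: IH => x /andP[xd xk]; have [|_ H] := cK (0%N :: x).
      by rewrite /in_grid /= eqSS xd xk.
    have [/(_ erefl) /=] := H 0%N isT; rewrite subn0 ltnS => cd _; split=> // i id.
    by have := H i.+1 id; rewrite subSS.
  by move=> l; exact: rainbow_map.
move=> s _; apply: gridsum_coboundary => // i e l id ek dl le.
apply/eqP/negPn/negP => /prism_neq0 [l' [rl H']].
have idd : (d - i.+1 < d.+1)%N by rewrite ltnS leq_subr.
have Hy y : y \in l' -> [/\ in_grid d.+1 y & nth 0%N y i.+1 = e].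
  case/H' => x xl yx; have := le _ xl; have /andP[/eqP xd xk] := allP dl _ xl.
  by case: yx => ->; split=> //; rewrite /in_grid /= xd eqxx xk andbT /= ?(ltnW (ltn_ord s)) ?ltn_ord.
case/orP: ek => /eqP ee.
  have [y /Hy [yd ye] cy] := rainbow_neq0 rl (ltnSn d).
  have [_ /(_ i.+1 id) [+ _]] := cK y yd; rewrite ye => /(_ ee); rewrite cy subSS; lia.
have [y /Hy [yd ye] cy] := rainbow_neq0 rl idd.
by have [_ /(_ i.+1 id) [_]] := cK y yd; rewrite ye => /(_ ee); rewrite cy subSS.
Qed.

(** Kuhn's cubical form of Sperner's lemma: a nonzero sum has a nonzero term,
    and [rainbow] is nonzero only where all the colours occur. *)
Lemma kuhn_cell d c : kuhn_coloring d c -> exists b l,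
  [/\ size b = d, all (ltn^~ k) b, all (in_cell b) l &
      forall j, (j <= d)%N -> exists2 x, x \in l & c x = j].
Proof.
move=> /gridsum_rainbow /gridsum_neq0 [b [l [bd bk bl rl]]].
by exists b, l; split=> // j jd; exact: (rainbow_neq0 rl).
Qed.

End Grid.

(** * The covering dimension of a space containing a cube *)

Section CubeCover.
Variables (R : realType) (d : nat).
Implicit Types (u v : 'rV[R]_d) (x : seq nat).

Definition unit_cube : set 'rV[R]_d := [set u | forall j, 0 <= u ord0 j <= 1].

Definition cube_facet (j : 'I_d) (b : bool) : set 'rV[R]_d :=
  [set u | unit_cube u /\ u ord0 j = b%:R].

Lemma compact_unit_cube : compact unit_cube.
Proof.
have := @rV_compact R d (fun=> `[0, 1]%classic) (fun=> @segment_compact R 0 1).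
by congr (compact _); apply/seteqP; split=> u /= H j; have := H j; rewrite in_itv.
Qed.

Lemma compact_cube_facet j b : compact (cube_facet j b).
Proof.
pose A i : set R := if i == j then [set b%:R] else `[0, 1]%classic.
have Ac i : compact (A i).
  by rewrite /A; case: ifP => _; [exact: compact_set1|exact: segment_compact].
have := rV_compact Ac; congr (compact _); apply/seteqP; split=> u /=.
  move=> H; split; last by have := H j; rewrite /A eqxx.
  move=> i; have := H i; rewrite /A; case: ifP => _ /=; last by rewrite in_itv.
  by move=> ->; case: b {A Ac H}; rewrite !lexx ?ler01.
move=> [uc uj] i; rewrite /A; case: eqP => [->//|_].
by rewrite /= in_itv /=; exact: uc.
Qed.

(** Grid points list their coordinates in reverse order. *)
Definition grid_point k x : 'rV[R]_d :=
  \row_(j < d) ((nth 0%N x (d - j.+1))%:R / k%:R).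

Lemma unit_cube_grid_point k x : (0 < k)%N -> in_grid k d x ->
  unit_cube (grid_point k x).
Proof.
move=> k0 /andP[/eqP xd xk] j; rewrite mxE divr_ge0 //=.
rewrite ler_pdivrMr ?ltr0n // mul1r ler_nat.
by apply: (allP xk); rewrite mem_nth // xd; have := ltn_ord j; lia.
Qed.

Lemma in_cell_grid_point k b x j : (0 < k)%N -> in_cell b x ->
  `|grid_point k x ord0 j - grid_point k b ord0 j| <= k%:R^-1.
Proof.
move=> k0 bx; rewrite !mxE -mulrBl normrM [ `|k%:R^-1|]ger0_norm ?invr_ge0 //.
rewrite ler_piMl ?invr_ge0 //; move: (d - j.+1)%N => i.
have : (nth 0 b i <= nth 0 x i <= (nth 0 b i).+1)%N.
  elim: b x bx i => [|b0 b IH] [|x0 x] //=; first by move=> _ i; rewrite nth_nil.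
  by move=> /andP[h bx] [|i] //=; exact: IH.
move=> /andP[h1]; rewrite -natrB // ger0_norm // -ltnS => h2.
by rewrite -[1]/(1%:R) ler_nat; lia.
Qed.

(** Here [1 / k] is a Lebesgue number of the cover pulled back to the cube; it
    serves below both as the radius and as the step of the grid. *)
Lemma lebesgue_grid (X : topologicalType) (f : 'rV[R]_d -> X) (V : set (set X)) :
  continuous f -> open_cover V ->
  exists2 k, (0 < k)%N & forall u, unit_cube u -> exists2 B, V B &
    forall v, (forall j, `|u ord0 j - v ord0 j| <= k%:R^-1) -> B (f v).
Proof.
move=> cf [Vo VT].
have /compact_near_coveringP := compact_unit_cube.
move=> /(_ nat \oo (fun k u => exists2 B, V B &
    forall v, (forall j, `|u ord0 j - v ord0 j| <= k.+1%:R^-1) -> B (f v))) [].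
  move=> u _.
  have : [set: X] (f u) by []. rewrite -VT => -[B VB Bfu].
  have /cf : nbhs (f u) B by apply: open_nbhs_nbhs; split=> //; exact: Vo.
  move=> /nbhs_ballP[e /= e0 eB].
  have e20 : 0 < e / 2 by rewrite divr_gt0.
  have := near_infty_natSinv_lt (PosNum e20) => /= Hk.
  exists (ball u (e / 2), [set k : nat | k.+1%:R^-1 < e / 2]) => /=.
    by split=> //; exact: nbhsx_ballx.
  move=> [u' k] /= [[_ uu'] ke]; exists B => // v uv; apply: eB; split=> // i j.
  rewrite (ord1 i); have h1 := uu' ord0 j; rewrite /ball /=.
  apply: le_lt_trans (ler_distD (u' ord0 j) _ _) _; rewrite (splitr e).
  by apply: ltrD => //; exact: le_lt_trans (uv j) ke.
by move=> N _ /(_ N (leqnn N)) H; exists N.+1.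
Qed.

(** Lebesgue's covering theorem, in the form of a lower bound for the covering
    dimension of [X].  The cover whose members each avoid one facet of every
    pair of opposite facets has no refinement of small order: a fine grid,
    labelled by members of the refinement and coloured by the first facet
    through 0 that the label meets, has a cell that carries all the colours. *)
Lemma cube_not_refinable (X : topologicalType) (f : 'rV[R]_d -> X) :
  hausdorff_space X -> continuous f ->
  (forall j u v, cube_facet j false u -> cube_facet j true v -> f u <> f v) ->
  ~ refinable X d.
Proof.
move=> hX cf fF ref.
have clF j b : closed (f @` cube_facet j b).
  apply: compact_closed => //; apply: continuous_compact; last exact: compact_cube_facet.
  exact: continuous_subspaceT.
pose W (s : 'I_d -> bool) : set X := ~` \bigcup_j (f @` cube_facet j (s j)).
have [|V [[Vo VT] VW Vn]] := ref (range W).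
  split.
    move=> _ [s _ <-]; rewrite openC; apply: closed_bigcup => //.
    exact: finite_finset.
  apply/seteqP; split=> // y _.
  have [s Hs] : exists s : 'I_d -> bool, forall j, ~ (f @` cube_facet j (s j)) y.
    suff /choice[s ?] : forall j, exists b, ~ (f @` cube_facet j b) y by exists s.
    move=> j.
    have [[u uF fu]|?] := pselect ((f @` cube_facet j false) y); last by exists false.
    by exists true => -[v vF fv]; apply: (fF j u v) => //; rewrite fu fv.
  by exists (W s); [exists s|move=> [j _]; exact: Hs].
(* The colour of a label is the first direction in which it meets the facet
   through 0, and d if there is none. *)
have [k k0 Hk] := lebesgue_grid cf (conj Vo VT).
pose meets (B : set X) (j : nat) : bool :=
  `[< exists (j' : 'I_d) u, [/\ val j' = j, cube_facet j' false u & B (f u)] >].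
pose color B := find (meets B) (iota 0 d).
have color_le B : (color B <= d)%N by have := find_size (meets B) (iota 0 d); rewrite size_iota.
have meets_color B j : (j < d)%N -> meets B j -> (color B <= j)%N.
  move=> jd; apply: contraTT; rewrite -ltnNge => jB.
  by have := before_find 0%N jB; rewrite nth_iota // add0n => ->.
have color_meets B : (color B < d)%N -> meets B (color B).
  move=> cB; have : has (meets B) (iota 0 d) by rewrite has_find size_iota.
  by move=> /(nth_find 0%N); rewrite nth_iota.
have [lab labP] : exists lab : seq nat -> set X, forall x, in_grid k d x ->
    V (lab x) /\ forall v, (forall j, `|grid_point k x ord0 j - v ord0 j| <= k%:R^-1) ->
      lab x (f v).
  suff /choice[lab ?] : forall x, exists B, in_grid k d x -> V B /\ forall v,
     (forall j, `|grid_point k x ord0 j - v ord0 j| <= k%:R^-1) -> B (f v) by exists lab.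
  move=> x.
  have [/(unit_cube_grid_point k0) /Hk [B VB HB]|nx] := boolP (in_grid k d x).
    by exists B.
  by exists set0.
have labx x : in_grid k d x -> lab x (f (grid_point k x)).
  by move=> /labP[_]; apply=> j; rewrite subrr normr0 invr_ge0.
have kc : kuhn_coloring k d (color \o lab).
  move=> x xg; split=> [|i id]; first exact: color_le.
  have jd : (d - i.+1 < d)%N by lia.
  pose j := Ordinal jd.
  have ux := unit_cube_grid_point k0 xg.
  have pj : grid_point k x ord0 j = (nth 0%N x i)%:R / k%:R.
    by rewrite mxE /= (_ : (d - (d - i.+1).+1 = i)%N) //; lia.
  split=> xi.
    suff /(meets_color _ _ jd) : meets (lab x) (d - i.+1)%N by move=> /=; lia.
    apply/asboolP; exists j, (grid_point k x); split=> //; last exact: labx.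
    by split=> //; rewrite pj xi mul0r.
  (* A label of a point of the facet u_j = 1 misses the facet u_j = 0. *)
  move=> /= cj; have := color_meets (lab x); rewrite cj => /(_ jd) /asboolP.
  move=> [j' [u [jj' uF Bu]]]; have {jj'} j'j : j' = j by exact: val_inj.
  subst j'.
  have [VB _] := labP x xg; have [_ [s _ <-] BW] := VW _ VB.
  case sj : (s j).
    apply: (BW _ (labx x xg)); exists j => //; exists (grid_point k x) => //.
    by rewrite sj; split=> //; rewrite pj xi divff // pnatr_eq0 -lt0n.
  by apply: (BW _ Bu); exists j => //; exists u => //; rewrite sj.
have [b [l [bd bk bl lc]]] := kuhn_cell kc.
pose y := f (grid_point k b).
(* Labels of different colours are different, and those of the points of one
   cell all contain the image of its lowest corner. *)
have [g gP] : exists g : nat -> seq nat, forall j, (j <= d)%N ->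
    g j \in l /\ color (lab (g j)) = j.
  suff /choice[g ?] : forall j, exists x, (j <= d)%N -> x \in l /\ color (lab x) = j.
    by exists g.
  move=> j.
  have [/lc [x xl <-]|jd] := leqP j d; first by exists x.
  by exists [::].
have : (`I_d.+1 #<= `I_d)%card; last by rewrite card_le_II ltnn.
apply: card_le_trans (Vn y).
have /(_ `I_d.+1) := @inj_card_eq _ _ _ (lab \o g).
have ginj : {in `I_d.+1 &, injective (lab \o g)}.
  move=> i j; rewrite !inE /= !ltnS => /gP[_ gi] /gP[_ gj] e.
  by rewrite -gi -gj e.
move=> /(_ ginj)/card_esym; rewrite card_eq_le => /andP[h _].
apply: card_le_trans h _; apply: subset_card_le => _ [j /= jd <-].
rewrite ltnS in jd; have [gl _] := gP j jd; have bg := allP bl _ gl.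
have [VB HB] := labP _ (in_cell_grid bd bk bg); split=> //.
by apply: HB => i; exact: in_cell_grid_point.
Qed.

End CubeCover.

(** * Subsets of dimension zero and covering dimension *)

Section ZeroDimensional.
Variable X : topologicalType.
Implicit Types (Z : set X).

(** A family of open sets whose boundaries avoid [Z] and that contains a
    neighbourhood base of every point of [Z]. *)
Definition zero_dim_base (I : Type) Z (B : I -> set X) :=
  [/\ forall i, open (B i), forall i, closure (B i) `&` Z `<=` B i &
      forall x U, Z x -> nbhs x U -> exists2 i, B i x & B i `<=` U].

Definition zero_dim Z := exists B : nat -> set X, zero_dim_base Z B.

Lemma zero_dim_countType (I : countType) Z (B : I -> set X) :
  zero_dim_base Z B -> zero_dim Z.
Proof.
case=> Bo Bc Bn; exists (fun n => if @choice.unpickle I n is Some i then B i else set0).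
split=> [n|n|x U Zx /(Bn _ _ Zx) [i Bx BU]].
- by case: choice.unpickle => // *; exact: open0.
- by case: choice.unpickle => // *; rewrite closure0 set0I.
- by exists (choice.pickle i); rewrite choice.pickleK.
Qed.

(** Replacing each basic set by its difference with the closures of the earlier
    ones makes the family disjoint, and loses no point of [Z]. *)
Lemma zero_dim_refinement Z (U : set (set X)) : zero_dim Z -> open_cover U ->
  exists (D : set nat) (V : nat -> set X),
   [/\ forall n, open (V n), forall n, D n -> exists2 A, U A & V n `<=` A,
       trivIset D V & Z `<=` \bigcup_(n in D) V n].
Proof.
move=> [B [Bo Bc Bn]] [Uo UT].
pose D n := exists2 A, U A & B n `<=` A.
pose V n := B n `&` ~` \bigcup_(m in [set m | D m /\ (m < n)%N]) closure (B m).
have VV m n x : D m -> (m < n)%N -> V m x -> V n x -> False.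
  by move=> Dm mn [Bx _] [_]; apply; exists m => //; exact: subset_closure.
exists D, V; split.
- move=> n; apply: openI => //; rewrite openC; apply: closed_bigcup.
    by apply: sub_finite_set (finite_II n) => m [].
  by move=> m _; exact: closed_closure.
- by move=> n [A UA BA]; exists A => // x [/BA].
- move=> m n Dm Dn [x [Vm Vn]].
  by case: (ltngtP m n) => // mn; exfalso; [exact: (VV m n x)|exact: (VV n m x)].
- move=> x Zx; have : [set: X] x by []. rewrite -UT => -[A UA Ax].
  have /(Bn _ _ Zx)[n Bnx BA] : nbhs x A by apply: open_nbhs_nbhs; split => //; exact: Uo.
  have ex : exists n, `[< D n /\ B n x >] by exists n; apply/asboolP; split => //; exists A.
  case: (ex_minnP ex) => m /asboolP[Dm Bm] mmin.
  exists m => //; split=> // -[l [Dl lm] Bl].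
  have /mmin : `[< D l /\ B l x >] by apply/asboolP; split => //; apply: Bc.
  by rewrite leqNgt lm.
Qed.

(** The easy half of the decomposition theorem: a union of [m] subsets of
    dimension zero has covering dimension less than [m]. *)
Lemma zero_dim_refinable m (Z : 'I_m -> set X) :
  (forall i, zero_dim (Z i)) -> (forall x, exists i, Z i x) -> refinable X m.
Proof.
move=> Z0 ZT U Uc.
have /choice[D H] := fun i => zero_dim_refinement (Z0 i) Uc.
have /choice[V {}H] := H.
pose W := [set B | exists i n, D i n /\ B = V i n].
exists W; split.
- split; first by move=> _ [i [n [_ ->]]]; have [] := H i.
  apply/seteqP; split=> // x _; have [i Zx] := ZT x.
  by have [_ _ _ /(_ x Zx) [n Dn Vx]] := H i; exists (V i n) => //; exists i, n.
- by move=> _ [i [n [Dn ->]]]; have [_ + _ _] := H i; apply.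
move=> x.
have /choice[k Hk] : forall B, exists i : nat,
    W B /\ B x -> exists (i' : 'I_m) n, [/\ val i' = i, D i' n & B = V i' n].
  move=> B; have [[[i [n [Dn BV]]] Bx]|?] := pselect (W B /\ B x); last by exists 0%N.
  by exists i => _; exists i, n.
have kinj : {in [set B | W B /\ B x] &, injective k}.
  move=> A B; rewrite !inE => /= WA WB kAB.
  have [i [n [ik Dn AV]]] := Hk _ WA; have [j [n' [jk Dn' BV]]] := Hk _ WB.
  have ij : i = j by apply: val_inj; rewrite ik jk.
  subst j; rewrite AV BV; have [_ _ + _] := H i.
  move=> /(_ n n' Dn Dn') -> //; exists x; split; first by rewrite -AV; case: WA.
  by rewrite -BV; case: WB.
have := inj_card_eq kinj; rewrite card_eq_le => /andP[_ h].
apply: card_le_trans h _; apply: subset_card_le => _ [B /Hk[i [n [<- _ _]]] <-] /=.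
exact: ltn_ord.
Qed.

End ZeroDimensional.

Lemma zero_dimX (X Y : topologicalType) (Z : set X) (Z' : set Y) :
  zero_dim Z -> zero_dim Z' -> zero_dim (Z `*` Z').
Proof.
move=> [B [Bo Bc Bn]] [B' [B'o B'c B'n]].
apply: (@zero_dim_countType _ (nat * nat)%type _ (fun i => B i.1 `*` B' i.2)).
split=> [[i j]|[i j] [x y] [/= cl [Zx Z'y]]|[x y] U [/= Zx Z'y] [[N N'] /= [Nx N'y] NU]].
- rewrite openE => -[x y] [/= Bx By]; exists (B i, B' j) => //=.
  by split; apply: open_nbhs_nbhs; split.
- split; [apply: Bc|apply: B'c]; split=> // N Nx.
    have [|[x' y'] [[/= ? _] [/= ? _]]] := cl (N `*` setT); last by exists x'.
    by exists (N, setT) => //=; split => //; exact: filterT.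
  have [|[x' y'] [[_ ?] /= [_ ?]]] := cl (setT `*` N); last by exists y'.
  by exists (setT, N) => //=; split => //; exact: filterT.
- have [i ? iN] := Bn _ _ Zx Nx; have [j ? jN] := B'n _ _ Z'y N'y.
  exists (i, j) => //= -[x' y'] [/= ? ?]; apply: NU; split => /=; [exact: iN|exact: jN].
Qed.

Lemma zero_dim_row (X : topologicalType) n (Z : set X) :
  zero_dim Z -> zero_dim [set u : 'rV[X]_n | forall j, Z (u ord0 j)].
Proof.
move=> [B [Bo Bc Bn]].
apply: (@zero_dim_countType _ {ffun 'I_n -> nat} _
  (fun f => [set u : 'rV[X]_n | forall j, B (f j) (u ord0 j)])).
split=> [f|f u [/= cl Zu]|u U /= Zu [P Pu PU]].
- rewrite openE => u /= Bu; exists (fun _ j => B (f j)) => /=.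
    by move=> i j; rewrite (ord1 i); apply: open_nbhs_nbhs; split.
  by move=> v H j; have := H ord0 j.
- move=> j; apply: Bc; split=> // N Nu.
  have [|v [Bv Nv]] := cl [set v | N (v ord0 j)]; last by exists (v ord0 j).
  exists (fun i l => if l == j then N else setT) => /=.
    by move=> i l; rewrite (ord1 i); case: eqP => [->|_] //; exact: filterT.
  by move=> v /(_ ord0 j); rewrite eqxx.
- have /choice[f Hf] : forall j, exists k, B k (u ord0 j) /\ B k `<=` P ord0 j.
    by move=> j; have [k ? ?] := Bn _ _ (Zu j) (Pu ord0 j); exists k.
  exists (finfun f) => [j|v Bv]; first by rewrite ffunE; have [] := Hf j.
  apply: PU => i j; rewrite (ord1 i); have [_] := Hf j; apply.
  by have := Bv j; rewrite ffunE.
Qed.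

Section FiniteProduct.
Variables (I : finType) (K : I -> topologicalType).
Implicit Types x : prod_topology K.

Lemma nbhs_prodP x U : nbhs x U <->
  exists2 P : forall i, set (K i), (forall i, nbhs (x i) (P i)) &
    [set y | forall i, P i (y i)] `<=` U.
Proof.
split=> [|[P Px]]; last first.
  move=> PU; apply: filterS PU _.
  apply: (@filter_forall _ I (fun i => [set y | P i (y i)]) (nbhs x)) => i.
  exact: (@proj_continuous _ K i x (P i) (Px i)).
pose F : set_system (prod_topology K) := filter_from
  [set P : forall i, set (K i) | forall i, nbhs (x i) (P i)]
  (fun P => [set y | forall i, P i (y i)]).
have FF : Filter F.
  apply: filter_from_filter; first by exists (fun=> setT) => i; exact: filterT.
  move=> P Q Px Qx; exists (fun i => P i `&` Q i); first by move=> i; exact: filterI.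
  by move=> y H; split=> i; have [] := H i.
suff : F --> x by move=> /[apply] -[P Px PU]; exists P.
apply/cvg_sup => i A [_ /= [[W oW <-]]] /= Wx.
move=> /filterS; apply.
exists (dfwith (fun=> setT) i W) => [j|y /(_ i)]; last by rewrite dfwithin.
by case: dfwithP => [|l _]; [exact: open_nbhs_nbhs|exact: filterT].
Qed.

Lemma prod_continuous (X : topologicalType) (f : X -> prod_topology K) :
  (forall i, continuous (fun z : X => f z i)) -> continuous f.
Proof.
move=> cf z U /nbhs_prodP[P Pz PU].
have Pf : nbhs z [set y | forall i, P i (f y i)].
  apply: (@filter_forall _ I (fun i => [set y | P i (f y i)]) (nbhs z)) => i.
  exact: (cf i z _ (Pz i)).
apply: filterS Pf => y Hy.
exact: PU.
Qed.

Lemma zero_dim_prod (Z : forall i, set (K i)) :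
  (forall i, zero_dim (Z i)) -> zero_dim [set x : prod_topology K | forall i, Z i (x i)].
Proof.
move=> H; have {H} [B H] : exists B : forall i, nat -> set (K i),
    forall i, zero_dim_base (Z i) (B i).
  by exists (fun i => projT1 (cid (H i))) => i; case: cid.
apply: (@zero_dim_countType _ {ffun I -> nat} _
  (fun f => [set x : prod_topology K | forall i, B i (f i) (x i)])).
split=> [f|f x [/= cl Zx]|x U /= Zx /nbhs_prodP [P Px PU]].
- rewrite openE => x /= Bx; apply/nbhs_prodP; exists (fun i => B i (f i)) => // i.
  by apply: open_nbhs_nbhs; split=> //; have [] := H i.
- move=> i; have [_ + _] := H i; apply; split=> // N Nx.
  have [|y [By Ny]] := cl [set y | N (y i)]; last by exists (y i).
  exact: (@proj_continuous _ K i x).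
- have [f Hf] : exists f : forall i, nat, forall i, B i (f i) (x i) /\ B i (f i) `<=` P i.
    suff /choice[f ?] : forall i, exists n, B i n (x i) /\ B i n `<=` P i by exists f.
    by move=> i; have [_ _ /(_ _ _ (Zx i) (Px i)) [n ? ?]] := H i; exists n.
  exists (finfun f) => [i|y By]; first by rewrite ffunE; have [] := Hf i.
  apply: PU => i; have [_] := Hf i; apply.
  by have := By i; rewrite ffunE.
Qed.

End FiniteProduct.

(** * Quotients by proper actions *)

Section Quotient.
Variables (X : topologicalType) (r : X -> X -> Prop) (r_equiv : equivalence X r).
Local Notation pi := (quot_map r_equiv).

Lemma quot_continuous (Y : topologicalType) (f : quot_space r_equiv -> Y) :
  continuous (f \o pi) -> continuous f.
Proof. by move=> /continuousP cf; apply/continuousP => A /cf. Qed.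

End Quotient.

Lemma near_finite (X : topologicalType) (I : choiceType) (F : set I)
    (P : I -> set X) (x : X) :
  finite_set F -> (forall i, F i -> nbhs x (P i)) ->
  nbhs x [set y | forall i, F i -> P i y].
Proof.
move=> /finite_fsetP[A ->] Px.
apply: filterS (@filter_bigI _ _ A P (nbhs x) _ Px) => y H i iA; exact: H.
Qed.

Lemma not_nbhs_disjoint (X : topologicalType) (x y : X) :
  hausdorff_space X -> x <> y ->
  exists A B, [/\ nbhs x A, nbhs y B & forall z, A z -> ~ B z].
Proof.
move=> hX; apply: contra_notP => H; apply: hX => A B Ax By.
apply: contrapT => AB; apply: H; exists A, B; split=> // z Az Bz.
by apply: AB; exists z.
Qed.

Lemma locally_compact_nbhs (X : topologicalType) : hausdorff_space X ->
  (forall x : X, exists2 K, nbhs x K & compact K) -> locally_compact [set: X].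
Proof.
move=> hX H x _; have [K Kx cK] := H x; exists K; first by rewrite withinET.
by split=> //; exact: compact_closed.
Qed.

Section ProperAction.
Variables (X : topologicalType) (G : choiceType) (act : G -> X -> X).
Variables (r : X -> X -> Prop) (r_equiv : equivalence X r).
Hypothesis rE : forall x y, r x y <-> exists g, y = act g x.
Hypothesis act_continuous : forall g, continuous (act g).
Local Notation pi := (quot_map r_equiv).

Lemma quot_map_actP x y : pi x = pi y <-> exists g, y = act g x.
Proof. by rewrite -rE; exact: quot_mapP. Qed.

Lemma quot_map_act g x : pi (act g x) = pi x.
Proof. by apply/esym/quot_map_actP; exists g. Qed.

Lemma quot_map_open A : open A -> open (pi @` A).
Proof.
move=> Ao; suff -> : open (pi @` A) = open (\bigcup_g (act g @^-1` A)).
  by apply: bigcup_open => g _; have /continuousP := @act_continuous g; exact.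
rewrite -[LHS]/(open (pi @^-1` (pi @` A))); congr open; apply/seteqP.
split=> x /=; first by move=> [y Ay /esym /quot_map_actP[g yx]]; exists g; rewrite //= -yx.
by move=> [g _ Ax]; exists (act g x) => //; exact: quot_map_act.
Qed.

Lemma quot_map_nbhs x A : nbhs x A -> nbhs (pi x) (pi @` A).
Proof.
rewrite nbhsE => -[B [Bo Bx] BA]; apply: filterS (image_subset pi BA) _.
by apply: open_nbhs_nbhs; split; [exact: quot_map_open|exists x].
Qed.

Definition wandering (M : set X) := forall y : X, exists2 N, nbhs y N &
  finite_set [set g | exists2 z, N z & M (act g z)].

(** The neighbourhood [M] of [x] is chosen before [y]: this uniformity controls
    the closure of the image of [M] at points far from [x]. *)
Definition proper_action := forall x : X, exists2 M, nbhs x M & wandering M.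

(** Only finitely many translates of [x] have to be separated from [y]. *)
Lemma quot_hausdorff : proper_action -> hausdorff_space X ->
  hausdorff_space (quot_space r_equiv).
Proof.
move=> pX hX p q clpq; rewrite -[p]quot_reprK -[q]quot_reprK.
move: clpq; rewrite -{1}[p]quot_reprK -{1}[q]quot_reprK.
move: (quot_repr p) (quot_repr q) => x y clpq.
apply/quot_map_actP; apply: contrapT => xy.
have [M My /(_ x) [N Nx]] := pX y; set F := (X in finite_set X) => Ff.
have /choice[A HA] : forall g, exists AB : set X * set X,
    [/\ nbhs (act g x) AB.1, nbhs y AB.2 & forall z, AB.1 z -> ~ AB.2 z].
  move=> g; have [|A [B [? ? ?]]] := @not_nbhs_disjoint _ (act g x) y hX.
    by move=> gx; apply: xy; exists g.
  by exists (A, B).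
have Nx' : nbhs x (N `&` [set z | forall g, F g -> (A g).1 (act g z)]).
  apply: filterI => //; apply: (@near_finite _ _ _ (fun g => act g @^-1` (A g).1)) => // g _.
  by apply: act_continuous; have [] := HA g.
have My' : nbhs y (M `&` [set z | forall g, F g -> (A g).2 z]).
  by apply: filterI => //; apply: near_finite => // g _; have [] := HA g.
have [_ [[z [Nz Az] <-] [w [Mw Aw] /esym/quot_map_actP [g wz]]]] :=
  clpq _ _ (quot_map_nbhs Nx') (quot_map_nbhs My').
have Fg : F g by exists z; rewrite // -wz.
have [_ _ /(_ w)] := HA g; apply; last exact: Aw.
by rewrite wz; exact: Az.
Qed.

Lemma quot_compact_nbhs :
  (forall x : X, exists2 K, nbhs x K & compact K) ->
  forall y : quot_space r_equiv, exists2 K, nbhs y K & compact K.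
Proof.
move=> H y; have [K Kx cK] := H (quot_repr y).
exists (pi @` K); first by have := quot_map_nbhs Kx; rewrite quot_reprK.
apply: continuous_compact => //; apply: continuous_subspaceT.
exact: quot_map_continuous.
Qed.

(** If [B] is wandering, then the closure of its image is the image of its
    closure; so a boundary point of the image that comes from [Z] comes from a
    boundary point of [B] in [Z]. *)
Lemma quot_zero_dim (Z : set X) : proper_action ->
  (forall g x, Z x -> Z (act g x)) -> zero_dim Z -> zero_dim (pi @` Z).
Proof.
move=> pX Zact [B [Bo Bc Bn]].
exists (fun n => [set y | wandering (B n) /\ (pi @` B n) y]); split.
- move=> n; have [wB|nB] := pselect (wandering (B n)).
    rewrite (_ : [set _ | _] = pi @` B n); first exact: quot_map_open.
    by apply/seteqP; split=> // y [].
  by rewrite (_ : [set _ | _] = set0); [exact: open0|apply/seteqP; split=> // y []].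
- move=> n y' [+ [y Zy yy']]; rewrite -yy' => cl {y' yy'}.
  have wB : wandering (B n).
    by have [z [[]]] := cl setT filterT.
  split=> //; have [N Ny] := wB y; set F := (X in finite_set X) => Ff.
  have [[g [Fg clg]]|H] := pselect (exists g, F g /\ closure (B n) (act g y)).
    by exists (act g y); [apply: Bc; split => //; exact: Zact|exact: quot_map_act].
  have /choice[P HP] : forall g, exists P, F g ->
      nbhs (act g y) P /\ forall z, B n z -> ~ P z.
    move=> g; have [Fg|?] := pselect (F g); last by exists setT.
    apply: contrapT => nP; apply: H; exists g; split=> // P Py.
    apply: contrapT => BP; apply: nP; exists P => _; split=> // z Bz Pz.
    by apply: BP; exists z.
  have Ny' : nbhs y (N `&` [set z | forall g, F g -> P g (act g z)]).
    apply: filterI => //.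
    apply: (@near_finite _ _ _ (fun g => act g @^-1` P g)) => // g Fg.
    by apply: act_continuous; have [] := HP g Fg.
  have [_ [[_ [b Bb <-]] [z [Nz Pz]] /quot_map_actP[g bz]]] := cl _ (quot_map_nbhs Ny').
  have Fg : F g by exists z; rewrite // -bz.
  by have [_ /(_ b Bb)] := HP g Fg; rewrite bz; have := Pz g Fg.
- move=> _ U [x Zx <-] Ux; have [M Mx wM] := pX x.
  have Ux' : nbhs x (pi @^-1` U) by exact: quot_map_continuous.
  have [n Bx BU] := Bn _ _ Zx (filterI Mx Ux').
  exists n; last by move=> _ [_ [z /BU [_ ?] <-]].
  split; last by exists x.
  move=> y; have [N Ny Nf] := wM y; exists N => //.
  by apply: sub_finite_set Nf => g [z Nz /BU[]]; exists z.
Qed.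

End ProperAction.

(** * The topology of the p-adic numbers *)

Section PadicTopology.
Variables (R : realType) (p : prime_nat).
Local Notation Qp := (Qp R p).
Local Notation abs := (padic_abs R p).
Local Notation of_rat := (padic_of_rat R p).
Implicit Types (x y z : Qp) (q : rat) (e : R).

Lemma padic_ballE x e : ball x e = [set y | padic_norm (x - y) < e].
Proof. by []. Qed.

Lemma padic_normN x : padic_norm (- x) = padic_norm x.
Proof. by have := padic_norm_distC 0 x; rewrite sub0r subr0. Qed.

Lemma padic_norm_seq_lt (u : cauchy_seq R p) e : padic_seq_norm u < e ->
  \forall n \near \oo, abs (u n) < e.
Proof. by move=> ue; exact: (cvgr_lt _ (@padic_seq_cvg _ _ u)). Qed.

Lemma padic_seq_norm_le (u : cauchy_seq R p) e :
  (\forall n \near \oo, abs (u n) <= e) -> padic_seq_norm u <= e.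
Proof. by move=> ue; apply: limr_le; [exact: padic_seq_cvg|exact: ue]. Qed.

(** The ultrametric inequality in its strict form, which survives the passage to
    the limit thanks to a bound [e'] strictly between the norms and [e]. *)
Lemma padic_norm_ltD x y e :
  padic_norm x < e -> padic_norm y < e -> padic_norm (x + y) < e.
Proof.
move=> xe ye; pose e' := (Num.max (padic_norm x) (padic_norm y) + e) / 2.
have m : Num.max (padic_norm x) (padic_norm y) < e by rewrite gt_max xe ye.
have e'e : e' < e by rewrite /e'; lra.
have xe' : padic_norm x < e'.
  by apply: le_lt_trans (_ : _ <= Num.max (padic_norm x) (padic_norm y)) _;
    [rewrite le_max lexx|rewrite /e'; lra].
have ye' : padic_norm y < e'.
  by apply: le_lt_trans (_ : _ <= Num.max (padic_norm x) (padic_norm y)) _;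
    [rewrite le_max lexx orbT|rewrite /e'; lra].
apply: le_lt_trans e'e.
rewrite -[x + y](_ : padic_class (padic_repr x + padic_repr y) = _); last first.
  by rewrite -{2}[x]padic_reprK -{2}[y]padic_reprK /padic_class rmorphD.
rewrite padic_norm_class; apply: padic_seq_norm_le.
near=> n; apply: le_trans (padic_abs_ultra _ _ _ _) _.
by rewrite ge_max; apply/andP; split; apply: ltW; near: n; exact: padic_norm_seq_lt.
Unshelve. all: by end_near. Qed.

Lemma padic_norm_ltB x y e :
  padic_norm x < e -> padic_norm y < e -> padic_norm (x - y) < e.
Proof. by move=> xe ye; apply: padic_norm_ltD; rewrite ?padic_normN. Qed.

Lemma closure_padic_ball x e : closure (ball x e) `<=` ball x e.
Proof.
move=> y cl; have [e0|e0] := ltP 0 e.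
  have [z [/= xz yz]] := cl _ (nbhsx_ballx y e e0).
  move: xz yz; rewrite !padic_ballE /= => xz yz.
  by rewrite -(subrKA z); apply: padic_norm_ltD; rewrite // padic_norm_distC.
have [z [xz _]] := cl _ filterT; move: xz; rewrite padic_ballE /= => xz.
have := le_lt_trans (padic_dist_triangle x x z) => /(_ e).
have : 0 <= padic_norm (x - z).
  have := padic_dist_triangle z x x; have := padic_distC x z.
  by rewrite padic_distxx /padic_dist; lra.
by lra.
Qed.

Lemma padic_norm_near_rat x e : 0 < e -> exists q, padic_norm (x - of_rat q) < e.
Proof.
move=> e0; pose u := padic_repr x.
have e20 : 0 < e / 2 by rewrite divr_gt0.
have [N HN] := cauchy_seqP u e20; exists (u N).
rewrite -[x]padic_reprK /padic_of_rat -padic_classB padic_norm_class.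
apply: (@le_lt_trans _ _ (e / 2)); last by lra.
apply: padic_seq_norm_le; exists N => // n Nn; apply: ltW.
exact: HN.
Qed.

Lemma zero_dim_padic : zero_dim [set: Qp].
Proof.
apply: (@zero_dim_countType _ (rat * nat)%type _
  (fun i => ball (of_rat i.1) i.2.+1%:R^-1)).
split=> [i|i x [cl _]|x U _ /nbhs_ballP[e /= e0 eU]].
- rewrite openE => x xi; apply/nbhs_ballP; exists i.2.+1%:R^-1 => /=.
    by rewrite invr_gt0.
  move: xi; rewrite !padic_ballE /= => xi y /= xy.
  by rewrite -(subrKA x); apply: padic_norm_ltD.
- exact: closure_padic_ball cl.
- have [k _ /(_ k (leqnn k)) /= ke] := near_infty_natSinv_lt (PosNum e0).
  have k0 : 0 < k.+1%:R^-1 :> R by rewrite invr_gt0.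
  have [q xq] := padic_norm_near_rat x k0; exists (q, k).
    by rewrite padic_ballE /= padic_norm_distC.
  move=> y; rewrite padic_ballE /= => yq; apply: eU; rewrite padic_ballE /=.
  by rewrite -(subrKA (of_rat q)); apply: padic_norm_ltD; apply: lt_trans ke.
Qed.

Lemma padic_norm_ratM q x : padic_norm (of_rat q * x) = abs q * padic_norm x.
Proof.
rewrite -[x]padic_reprK /padic_of_rat -padic_classM !padic_norm_class.
rewrite /padic_seq_norm; apply/cvg_lim => //.
rewrite (_ : (fun n => _) = (fun n => abs q * abs (padic_repr x n))); last first.
  by apply/funext => n; exact: padic_absM.
by apply: cvgM; [exact: cvg_cst|exact: padic_seq_cvg].
Qed.

Lemma padic_ratM_continuous q : continuous (fun x : Qp => of_rat q * x).
Proof.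
move=> x U /nbhs_ballP[e /= e0 eU].
have q0 : 0 < abs q + 1 by have := padic_abs_ge0 R p q; lra.
apply/nbhs_ballP; exists (e / (abs q + 1)) => /=; first by rewrite divr_gt0.
move=> y; rewrite padic_ballE /= ltr_pdivlMr // => xy; apply: eU.
rewrite padic_ballE /= -mulrBr padic_norm_ratM; apply: le_lt_trans xy.
have n0 : 0 <= padic_norm (x - y).
  have := padic_dist_triangle y x x; have := padic_distC x y.
  by rewrite padic_distxx /padic_dist; lra.
by rewrite mulrC ler_wpM2l //; lra.
Qed.

(** Integers are dense in the unit ball, and only their residues modulo
    [p ^ k] matter at scale [p ^ - k]. *)
Lemma padic_residue q k : abs q < 1 ->
  exists2 j, (j < val p ^ k)%N & abs (q - j%:R) <= ((val p)%:R ^+ k)^-1.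
Proof.
move=> q1; set P := val p; have Pp : prime P := valP p.
have Pk0 : (0 < P ^ k)%N by rewrite expn_gt0 prime_gt0.
have P1 : 1 < P%:R :> R := prime_gt1R R p.
have [->|q0] := eqVneq q 0.
  by exists 0%N => //; rewrite subrr padic_abs0 invr_ge0 exprn_ge0.
have a0 : numq q != 0 by rewrite numq_eq0.
have b0 := denq_neq0 q.
have nPb : ~~ (P %| `|denq q|)%N.
  apply: contraTN q1 => Pb.
  have nPa : ~~ (P %| `|numq q|)%N.
    apply: contraTN (coprime_num_den q) => Pa; rewrite /coprime.
    apply: contraTneq Pp => g1; have : (P %| 1)%N by rewrite -g1 dvdn_gcd Pa Pb.
    by rewrite dvdn1 => /eqP ->.
  rewrite -leNgt /padic_abs (negbTE q0) -[X in X <= _](expr0z P%:R).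
  rewrite ler_eXz2l // /padic_val.
  have -> : logn P `|numq q| = 0%N by rewrite lognE (negbTE nPa) !andbF.
  by rewrite sub0r opprK.
have cop : coprimez (denq q) (P ^ k)%N.
  by rewrite coprimezE /= coprime_sym coprimeXl // prime_coprime.
have [j jP jm] : exists2 j, (j < P ^ k)%N & (((P ^ k)%N : int) %| numq q - j%:Z * denq q)%Z.
  have [[u v] /= uv] := coprimezP _ _ cop.
  pose m := (numq q * u %% (P ^ k)%N)%Z; pose w := (numq q * u %/ (P ^ k)%N)%Z.
  have Pk0' : ((P ^ k)%N : int) != 0 by lia.
  have m0 : 0 <= m by exact: modz_ge0.
  have mP : m < (P ^ k)%N by rewrite ltz_pmod.
  exists `|m|%N; first lia.
  rewrite gez0_abs //; have E : numq q * u = w * (P ^ k)%N + m := divz_eq _ _.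
  have -> : numq q - m * denq q = (numq q * v + w * denq q) * (P ^ k)%N.
    have -> : m = numq q * u - w * (P ^ k)%N by rewrite E addrAC subrr add0r.
    by rewrite -[X in X - _]mulr1 -uv; ring.
  exact: dvdz_mull.
exists j => //; have [->|d0] := eqVneq (q - j%:R) 0.
  by rewrite padic_abs0 invr_ge0 exprn_ge0.
have qE : q - j%:R = (numq q - j%:Z * denq q)%:~R / (denq q)%:~R.
  by rewrite -{1}[q]divq_num_den rmorphB rmorphM /= mulrBl mulfK ?intr_eq0.
have c0 : numq q - j%:Z * denq q != 0.
  by apply: contra_neq d0 => c0; rewrite qE c0 mul0r.
rewrite /padic_abs (negbTE d0) qE padic_val_frac // -/P.
have -> : logn P `|denq q| = 0%N by rewrite lognE (negbTE nPb) !andbF.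
rewrite subr0 -[X in _ <= X]/(P%:R ^- k) exprnN ler_eXz2l // lerN2 lez_nat.
by rewrite -pfactor_dvdn ?absz_gt0.
Qed.

(** A rational point near the centre reduces this to the unit ball around 0,
    where residues modulo a power of [p] form a net. *)
Lemma padic_ball_net x e : 0 < e -> exists n (c : nat -> rat),
  forall y, ball x 1 y -> exists2 j, (j < n)%N & ball (of_rat (c j)) e y.
Proof.
move=> e0; have e20 : 0 < e / 2 by rewrite divr_gt0.
have [x0 xx0] := padic_norm_near_rat x (@ltr01 R).
have [k _ /(_ k (leqnn k)) /= ke] := near_infty_natSinv_lt (PosNum e20).
exists (val p ^ k.+1)%N, (fun j => x0 + j%:R) => y xy.
have yx0 : padic_norm (y - of_rat x0) < 1.
  rewrite -(subrKA x); apply: padic_norm_ltD => //.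
  by rewrite padic_norm_distC.
have e1 : 0 < Num.min (e / 2) 1 by rewrite lt_min e20 ltr01.
have [q yq] := padic_norm_near_rat (y - of_rat x0) e1.
move: yq; rewrite lt_min => /andP[yqe yq1].
have q1 : abs q < 1.
  rewrite -padic_norm_rat -[of_rat q](subKr (y - of_rat x0)).
  exact: padic_norm_ltB.
have [j jk qj] := padic_residue k.+1 q1; exists j => //.
rewrite padic_ballE /= padic_norm_distC rmorphD opprD addrA.
rewrite -(subrKA (of_rat q)); apply: le_lt_trans (padic_normD _ _) _.
rewrite (splitr e); apply: ltrD => //.
rewrite -rmorphB padic_norm_rat; apply: le_lt_trans qj _; apply: lt_trans ke.
have P1 : (1 < val p)%N := prime_gt1 (valP p).
by rewrite -natrX ltf_pV2 ?posrE ?ltr0n ?expn_gt0 ?(ltnW P1) // ltr_nat ltn_expl.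
Qed.

Lemma ultra_finite_cover (T : Type) (F : set_system T) n (A : nat -> set T) :
  UltraFilter F -> F [set y | exists2 j, (j < n)%N & A j y] ->
  exists2 j, (j < n)%N & F (A j).
Proof.
move=> UF; elim: n => [|n IH] FA.
  by have [y [j]] := filter_ex FA.
have [|FnA] := in_ultra_setVsetC (A n) UF; first by exists n.
have [|j jn Fj] := IH; last by exists j => //; exact: ltnW.
apply: filterS (filterI FA FnA) => y [[j]]; rewrite ltnS leq_eqVlt.
by move=> /predU1P[-> //|jn] Ajy _; exists j.
Qed.

(** An ultrafilter on the ball contains balls of radii tending to 0 with rational
    centres; the centres form a Cauchy sequence, whose class is the limit. *)
Lemma padic_ball_compact x : compact (ball x 1).
Proof.
rewrite compact_ultra => F UF Fx.
have /choice[q Fq] : forall k : nat, exists q, F (ball (of_rat q) k.+1%:R^-1).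
  move=> k; have k0 : 0 < k.+1%:R^-1 :> R by rewrite invr_gt0.
  have [n [c cP]] := padic_ball_net x k0.
  have [|j _ Fj] := @ultra_finite_cover _ F n (fun j => ball (of_rat (c j)) k.+1%:R^-1) UF.
    by apply: filterS Fx => y /cP.
  by exists (c j).
have qq m n : abs (q m - q n) <= m.+1%:R^-1 + n.+1%:R^-1.
  have [y [ym yn]] := filter_ex (filterI (Fq m) (Fq n)).
  rewrite -padic_norm_rat rmorphB -(subrKA y); apply: le_trans (padic_normD _ _) _.
  apply: lerD; apply: ltW; first exact: ym.
  by rewrite padic_norm_distC; exact: yn.
have qc : q \in padic_cauchy R p.
  apply/asboolP => e e0; have e20 : 0 < e / 2 by rewrite divr_gt0.
  have [N _ HN] := near_infty_natSinv_lt (PosNum e20).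
  exists N => m n Nm Nn; apply: le_lt_trans (qq m n) _; rewrite (splitr e).
  by apply: ltrD; exact: HN.
pose L := padic_class (CauchySeq qc).
have Lq k : padic_norm (L - of_rat (q k)) <= k.+1%:R^-1 + k.+1%:R^-1.
  rewrite /L /padic_of_rat -padic_classB padic_norm_class.
  apply: padic_seq_norm_le; exists k => // n /= kn.
  apply: le_trans (qq n k) _; rewrite lerD2r lef_pV2 ?posrE ?ltr0n // ler_nat.
  exact: kn.
have FL : F --> L.
  move=> U /nbhs_ballP[e /= e0 eU]; have e40 : 0 < e / 4 by rewrite divr_gt0.
  have [k _ /(_ k (leqnn k)) /= ke] := near_infty_natSinv_lt (PosNum e40).
  apply: filterS (Fq k) => y yk; apply: eU; rewrite padic_ballE /=.
  rewrite -(subrKA (of_rat (q k))); apply: le_lt_trans (padic_normD _ _) _.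
  have := Lq k; have : padic_norm (of_rat (q k) - y) < k.+1%:R^-1 := yk.
  move: (padic_norm (L - _)) (padic_norm (_ - y)) (k.+1%:R^-1) ke => a b c; lra.
exists L; split=> //; apply: closure_padic_ball => U /FL FU.
exact: filter_ex (filterI Fx FU).
Qed.

End PadicTopology.

(** * Real numbers that avoid a rational affine class *)

Section Avoid.
Variable R : realType.
Implicit Types (alpha beta x : R) (q r : rat).

(** The complement of a countable dense set; the sets that are left out for
    two rationally independent values of [alpha] are disjoint. *)
Definition avoid alpha : set R :=
  [set x | forall q r, q != 0 -> x <> ratr q * alpha + ratr r].

Lemma avoidM alpha q x : q != 0 -> avoid alpha x -> avoid alpha (ratr q * x).
Proof.
move=> q0 ax s r s0 E; apply: (ax (s / q) (r / q)).
  by rewrite mulf_neq0 ?invr_eq0.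
apply: (@mulfI _ (ratr q)); first by rewrite fmorph_eq0.
by rewrite E !fmorph_div; field; rewrite fmorph_eq0.
Qed.

Lemma avoidD alpha q x : avoid alpha x -> avoid alpha (x + ratr q).
Proof.
move=> ax s r s0 E; apply: (ax s (r - q) s0).
by rewrite rmorphB addrA -E addrK.
Qed.

Lemma zero_dim_avoid alpha : zero_dim (avoid alpha).
Proof.
pose B (i : rat * rat) : set R := `]alpha + ratr i.1, alpha + ratr i.2[%classic.
have E x q : avoid alpha x -> x != alpha + ratr q.
  by move=> ax; apply/eqP => xq; apply: (ax 1 q) => //; rewrite rmorph1 mul1r.
apply: (@zero_dim_countType _ (rat * rat)%type _ B).
split=> [i|[a b] x [cl ax]|x U ax /nbhs_ballP[e /= e0 eU]].
- exact: interval_open.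
- have : closure `[alpha + ratr a, alpha + ratr b]%classic x.
    by apply: closureS cl; exact: subset_itv_oo_cc.
  rewrite -(closure_id _).1; last exact: interval_closed.
  rewrite /B /= !in_itv /= => /andP[xa xb].
  by rewrite !lt_neqAle xa xb (E x b ax) eq_sym (E x a ax).
- have [a] : exists a, ratr a \in `](x - e - alpha), (x - alpha)[ by apply: rat_in_itvoo; lra.
  rewrite in_itv /= => /andP[a1 a2].
  have [b] : exists a, ratr a \in `](x - alpha), (x + e - alpha)[ by apply: rat_in_itvoo; lra.
  rewrite in_itv /= => /andP[b1 b2].
  exists (a, b); rewrite /B /=; first by rewrite in_itv /=; apply/andP; split; lra.
  move=> y; rewrite /= in_itv /= => /andP[y1 y2]; apply: eU.
  by rewrite /ball /= ltr_distlC; apply/andP; split; lra.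
Qed.

Lemma countable_not_avoid alpha : countable (~` avoid alpha).
Proof.
have -> : ~` avoid alpha =
  (fun i : rat * rat => ratr i.1 * alpha + ratr i.2) @` [set i | i.1 != 0].
  apply/seteqP; split=> x; last by move=> [[q r] /= q0 <-] /(_ q r q0).
  move=> /existsNP[q /existsNP[r /not_implyP[q0 /contrapT ->]]].
  by exists (q, r).
apply: card_le_trans (card_image_le _ _) _; exact: countableP.
Qed.

Lemma countable_exists_notin (A : set R) : countable A -> exists x, ~ A x.
Proof.
move=> cA; apply: contrapT => /forallNP H.
have : countable (`[0, 1]%classic : set R).
  by apply: sub_countable cA; apply: subset_card_le => x _; exact: contrapT (H x).
move=> /countable_lebesgue_measure0; rewrite lebesgue_measure_itv /= lte_fin ltr01.
by rewrite -EFinD subr0 => -[] /eqP; rewrite oner_eq0.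
Qed.

(** The real line is uncountable, so a new number can be chosen off the
    countable sets excluded by the earlier ones. *)
Lemma exists_avoiding m : exists alpha : nat -> R,
  forall i j, (i < j < m)%N -> avoid (alpha i) (alpha j).
Proof.
elim: m => [|m [alpha H]]; first by exists (fun=> 0) => i j; rewrite ltn0 andbF.
have [|beta Hb] := @countable_exists_notin (\bigcup_i ~` avoid (alpha i)).
  by apply: bigcup_countable => // i _; exact: countable_not_avoid.
exists (fun i => if i == m then beta else alpha i) => i j /andP[ij].
have im : (j <= m)%N -> i != m by lia.
rewrite ltnS leq_eqVlt => /predU1P[jm|jm].
  subst j; rewrite eqxx (negbTE (im _)) //.
  by apply: contrapT => nb; apply: Hb; exists i.
rewrite (negbTE (im _)) 1?ltnW // ltn_eqF //; apply: H; by rewrite ij.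
Qed.

Lemma not_avoid2 alpha beta x : avoid alpha beta -> ~ avoid alpha x -> avoid beta x.
Proof.
move=> ab /existsNP[q /existsNP[r /not_implyP[q0 /contrapT xE]]] s t s0 xE'.
apply: (ab (q / s) ((r - t) / s)); first by rewrite mulf_neq0 ?invr_eq0.
apply: (@mulfI _ (ratr s)); first by rewrite fmorph_eq0.
rewrite [LHS](_ : _ = x - ratr t); last by rewrite xE' addrK.
by rewrite xE !fmorph_div rmorphB; field; rewrite fmorph_eq0.
Qed.

(** Each of fewer than [m] real numbers lies in at most one of the [m] disjoint
    excluded sets, so some excluded set contains none of them. *)
Lemma avoid_pigeonhole m (alpha : nat -> R) (I : finType) (x : I -> R) :
  (forall i j, (i < j < m)%N -> avoid (alpha i) (alpha j)) -> (#|I| < m)%N ->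
  exists i : 'I_m, forall c, avoid (alpha i) (x c).
Proof.
move=> H Im; apply: contrapT => /forallNP nx.
have /choice[k Hk] : forall i : 'I_m, exists c, ~ avoid (alpha i) (x c).
  by move=> i; exact/existsNP/nx.
have kinj : injective k.
  move=> i j kij; apply: contrapT => /eqP; rewrite neq_ltn => /orP[] ij.
    apply: (Hk j); rewrite -kij; apply: not_avoid2 (Hk i); apply: H.
    by rewrite ij ltn_ord.
  apply: (Hk i); rewrite kij; apply: not_avoid2 (Hk j); apply: H.
  by rewrite ij ltn_ord.
by have := leq_card _ kinj; rewrite card_ord leqNgt Im.
Qed.

End Avoid.

(** * The adele space and its quotients *)

Section Places.
Variable R : realType.

Definition Qv_avoid (alpha : R) (v : place) : set (Qv R v) :=
  match v with None => avoid alpha | Some p => [set: Qp R p] end.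

Lemma zero_dim_Qv alpha v : zero_dim (@Qv_avoid alpha v).
Proof. by case: v => [p|]; [exact: zero_dim_padic|exact: zero_dim_avoid]. Qed.

Lemma Qv_avoidM alpha q v (x : Qv R v) : q != 0 ->
  Qv_avoid alpha x -> Qv_avoid alpha (Qv_scale q x).
Proof. by case: v x => //= x q0; exact: avoidM. Qed.

Lemma Qv_hausdorff v : hausdorff_space (Qv R v).
Proof. by case: v => [p|]; [exact: metric_hausdorff|exact: Rhausdorff]. Qed.

Lemma Qv_compact_nbhs v (x : Qv R v) : exists2 K, nbhs x K & compact K.
Proof.
case: v x => [p|] x /=.
  by exists (ball (x : Qp R p) 1); [exact: nbhsx_ballx|exact: padic_ball_compact].
exists `[x - 1, x + 1]%classic; last exact: segment_compact.
apply/nbhs_ballP; exists 1 => //= y; rewrite /ball /= ltr_distlC => /andP[? ?].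
by rewrite in_itv /=; apply/andP; split; lra.
Qed.

Lemma Qv_scale_continuous q v : continuous (@Qv_scale R q v).
Proof.
case: v => [p|] /=; last exact: mulrl_continuous.
rewrite (_ : (fun x => _) = (fun x : Qp R p => padic_of_rat R p q * x)).
  exact: padic_ratM_continuous.
by apply/funext => x; rewrite ratr_Qp.
Qed.

Definition Qv_real (x : R) (v : place) : Qv R v :=
  match v with None => x | Some p => (0 : Qp R p) end.

Lemma Qv_real_continuous v : continuous (fun x : R => Qv_real x v).
Proof. by case: v => [p|] /=; [exact: cst_continuous|move=> x; exact: cvg_id]. Qed.

End Places.

Lemma hausdorff_prod (X Y : topologicalType) :
  hausdorff_space X -> hausdorff_space Y -> hausdorff_space (X * Y)%type.
Proof.
move=> hX hY [x y] [x' y'] cl; congr pair.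
  apply: hX => A B Ax Bx.
  have [||[a b] [[? _] [? _]]] := cl (A `*` setT) (B `*` setT).
  - by exists (A, setT) => //=; split => //; exact: filterT.
  - by exists (B, setT) => //=; split => //; exact: filterT.
  - by exists a.
apply: hY => A B Ax Bx.
have [||[a b] [[_ ?] [_ ?]]] := cl (setT `*` A) (setT `*` B).
- by exists (setT, A) => //=; split => //; exact: filterT.
- by exists (setT, B) => //=; split => //; exact: filterT.
- by exists b.
Qed.

Section AdeleSpace.
Variables (R : realType) (S : {fset place}).
Local Notation A := (adeles R S).
Local Notation n := (fin_rank S).

Lemma adele_hausdorff : hausdorff_space A.
Proof. by apply: hausdorff_product => v; exact: Qv_hausdorff. Qed.

Lemma adele_compact_nbhs (a : A) : exists2 K, nbhs a K & compact K.
Proof.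
have [K HK] : exists K : forall v : S, set (Qv R (val v)),
    forall v, nbhs (a v) (K v) /\ compact (K v).
  have H v := Qv_compact_nbhs (a v).
  exists (fun v => projT1 (cid2 (H v))) => v; by case: cid2.
exists [set b | forall v, K v (b v)].
  by apply/nbhs_prodP; exists K => // v; have [] := HK v.
by apply: tychonoff => v; have [] := HK v.
Qed.

Lemma adele_scale_continuous q : continuous (@adele_scale R S q).
Proof.
apply: prod_continuous => v a U /Qv_scale_continuous Uv.
exact: (@proj_continuous _ _ v a _ Uv).
Qed.

Definition adele_avoid alpha : set A := [set a | forall v, Qv_avoid alpha (a v)].

Lemma zero_dim_adele alpha : zero_dim (adele_avoid alpha).
Proof.
apply: (@zero_dim_prod _ (fun v : S => Qv R (val v)) (fun v => @Qv_avoid R alpha (val v))).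
by move=> v; exact: zero_dim_Qv.
Qed.

Lemma adele_avoidM alpha q a : q != 0 ->
  adele_avoid alpha a -> adele_avoid alpha (adele_scale q a).
Proof. by move=> q0 aa v; exact: Qv_avoidM. Qed.

Definition real_adele (x : R) : A := fun v => Qv_real x (val v).

Lemma real_adele_continuous : continuous real_adele.
Proof.
apply: (@prod_continuous _ (fun v : S => Qv R (val v))) => v.
exact: Qv_real_continuous.
Qed.

Definition infty_coord (S_infty : None \in S) (a : A) : R := a [` S_infty]%fset.

Lemma adele_avoid_infty (S_infty : None \in S) alpha (a : A) :
  avoid alpha (infty_coord S_infty a) -> adele_avoid alpha a.
Proof.
move=> aa [v vS]; case: v vS => [p|] vS //=.
by rewrite /Qv_avoid (bool_irrelevance vS S_infty).
Qed.

Definition sign_act (s : bool) : A -> A := adele_scale ((-1) ^+ s).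

Definition sign_rel (a b : A) := exists s, b = sign_act s a.

Fact sign_rel_equiv : equivalence A sign_rel.
Proof.
split.
- by move=> a; exists false; rewrite /sign_act expr0 adele_scale1.
- move=> a _ _ [s ->] [t ->]; exists (t (+) s).
  by rewrite /sign_act signr_addb adele_scaleM.
- move=> a _ [s ->]; exists s; rewrite /sign_act -adele_scaleM -signr_addb addbb.
  by rewrite expr0 adele_scale1.
Qed.

(** Over a small ball of translations only the sign identifies points, so this
    quotient is the transversal of the lamination. *)
Definition sign_quotient := quot_space sign_rel_equiv.

Definition sign_map : A -> sign_quotient := quot_map sign_rel_equiv.

Lemma sign_map_continuous : continuous sign_map.
Proof. exact: quot_map_continuous. Qed.

Lemma sign_relE a b : sign_rel a b <-> exists s, b = sign_act s a.
Proof. by []. Qed.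

Lemma sign_act_continuous s : continuous (sign_act s).
Proof. exact: adele_scale_continuous. Qed.

Lemma sign_proper : proper_action sign_act.
Proof.
move=> a; exists setT; first exact: filterT.
by move=> b; exists setT; [exact: filterT|exact: finite_finset].
Qed.

Lemma sign_hausdorff : hausdorff_space sign_quotient.
Proof.
apply: (@quot_hausdorff A bool sign_act sign_rel sign_rel_equiv sign_relE
  sign_act_continuous sign_proper adele_hausdorff).
Qed.

Lemma Gamma_val_neq0 (g : Gamma S) : Gamma_val g != 0.
Proof.
apply/eqP => g0; have := Gamma_valM (Gamma_inv g) g.
by rewrite Gamma_mulV Gamma_val1 g0 mulr0 => /eqP; rewrite oner_eq0.
Qed.

Lemma Gamma_val_sign b : Gamma_val ((b, 0) : Gamma S) = (-1) ^+ b.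
Proof. by rewrite /Gamma_val /= big1 ?mulr1 // => j _; rewrite mxE expr0z. Qed.

Local Notation X := (A * 'rV[R]_n)%type.
Local Notation GammaC := (bool * 'rV[int]_n)%type.

Lemma hquotient_relE (x y : X) :
  hquotient_rel x y <-> exists g : GammaC, y = Gamma_act g x.
Proof. by []. Qed.

Lemma Gamma_act_continuous (g : GammaC) : continuous (Gamma_act g : X -> X).
Proof.
move=> [a t] U [[N N'] /= [Na Nt] NU].
exists (adele_scale (Gamma_val g) @^-1` N, (fun s => s + Gamma_translation R g) @^-1` N') => /=.
  split; first exact: adele_scale_continuous.
  have tc : continuous (fun s : 'rV[R]_n => s + Gamma_translation R g).
    by move=> s; apply: continuousD; [exact: cvg_id|exact: cst_continuous].
  exact: tc.
by move=> [b s] [/= ? ?]; apply: NU.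
Qed.

Lemma row_nbhs (t : 'rV[R]_n) e : 0 < e ->
  nbhs t [set s | forall j, `|t ord0 j - s ord0 j| < e].
Proof.
move=> e0; exists (fun _ j => ball (t ord0 j) e) => /=.
  by move=> i j; rewrite (ord1 i); exact: nbhsx_ballx.
by move=> s H j; exact: (H ord0 j).
Qed.

Lemma intr_near_eq (k l : int) : `|k%:~R - l%:~R| < 1 :> R -> k = l.
Proof.
by rewrite -intrB -intr_norm -[1]/(1%:~R) ltr_int => ?; apply/eqP; rewrite -subr_eq0; lia.
Qed.

(** Two elements that move a ball of radius 1/4 to meet another one have
    translations at distance less than 1, which are then equal. *)
Lemma Gamma_proper : proper_action (fun g : GammaC => Gamma_act g : X -> X).
Proof.
have e0 : 0 < 1 / 4 :> R by lra.
move=> [a t]; exists [set x : X | forall j, `|t ord0 j - x.2 ord0 j| < 1 / 4].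
  exists (setT, [set s : 'rV[R]_n | forall j, `|t ord0 j - s ord0 j| < 1 / 4]) => /=.
    by split; [exact: filterT|exact: row_nbhs].
  by move=> [b s] [].
move=> [b s]; exists [set x : X | forall j, `|s ord0 j - x.2 ord0 j| < 1 / 4].
  exists (setT, [set u : 'rV[R]_n | forall j, `|s ord0 j - u ord0 j| < 1 / 4]) => /=.
    by split; [exact: filterT|exact: row_nbhs].
  by move=> [c u] [].
set F := (X in finite_set X).
have [->|/set0P[g0 [x0 x0s x0t]]] := eqVneq F set0; first exact: finite_set0.
apply: (@sub_finite_set _ _ [set (true, g0.2); (false, g0.2)]); last exact: finite_set2.
move=> g [x xs xt].
have E : g.2 = g0.2.
  apply/rowP => j; apply: intr_near_eq; move: (x0s j) (x0t j) (xs j) (xt j).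
  rewrite /= !mxE !ltr_norml => /andP[? ?] /andP[? ?] /andP[? ?] /andP[? ?].
  by apply/andP; split; lra.
by move: g E {xt} => [[] k] /= ->; [left|right].
Qed.

Lemma hquotient_hausdorff : hausdorff_space (adele_hquotient R S).
Proof.
apply: (@quot_hausdorff X GammaC (@Gamma_act R S) _ (@hquotient_rel_equiv R S)
  hquotient_relE Gamma_act_continuous Gamma_proper).
by apply: hausdorff_prod; [exact: adele_hausdorff|exact: norm_hausdorff].
Qed.

Lemma row_compact_nbhs (t : 'rV[R]_n) : exists2 K, nbhs t K & compact K.
Proof.
exists [set s : 'rV[R]_n | forall j, s ord0 j \in `[t ord0 j - 1, t ord0 j + 1]].
  apply: filterS (row_nbhs t (@ltr01 R)) => s H j; have := H j.
  by rewrite in_itv /= ltr_distlC => /andP[? ?]; apply/andP; split; lra.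
exact: (@rV_compact R n (fun j => `[t ord0 j - 1, t ord0 j + 1]%classic)
  (fun j => @segment_compact _ _ _)).
Qed.

Lemma hquotient_locally_compact : locally_compact [set: adele_hquotient R S].
Proof.
apply: locally_compact_nbhs; first exact: hquotient_hausdorff.
apply: (@quot_compact_nbhs X GammaC (@Gamma_act R S) _ (@hquotient_rel_equiv R S)
  hquotient_relE Gamma_act_continuous) => -[a t].
have [K Ka cK] := adele_compact_nbhs a; have [L Lt cL] := row_compact_nbhs t.
by exists (K `*` L); [exists (K, L)|exact: compact_setX].
Qed.

Lemma card_places (S_infty : None \in S) : #|` S| = n.+1.
Proof.
rewrite /fin_rank prednK // cardfs_gt0; apply/fset0Pn; by exists None.
Qed.

Lemma sign_quotient_dim (S_infty : None \in S) : has_covering_dim sign_quotient 1.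
Proof.
split.
  have [alpha aP] := exists_avoiding R 2.
  apply: (@zero_dim_refinable _ _ (fun i : 'I_2 => sign_map @` adele_avoid (alpha i))).
    move=> i; apply: (@quot_zero_dim A bool sign_act _ sign_rel_equiv sign_relE
      sign_act_continuous _ sign_proper).
      by move=> s a; apply: adele_avoidM; rewrite signr_eq0.
    exact: zero_dim_adele.
  move=> y; rewrite -[y]quot_reprK.
  have [|i Hi] := @avoid_pigeonhole _ 2 alpha unit
    (fun=> infty_coord S_infty (quot_repr y)) aP; first by rewrite card_unit.
  by exists i, (quot_repr y) => //; apply: adele_avoid_infty (Hi tt).
apply: (@cube_not_refinable R 1 _ (fun u => sign_map (real_adele (1 + u ord0 ord0)))).
- exact: sign_hausdorff.
- move=> u; apply: (@continuous_comp _ _ _ (fun u : 'rV[R]_1 => real_adele (1 + u ord0 ord0)) sign_map).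
    apply: (@continuous_comp _ _ _ (fun u : 'rV[R]_1 => 1 + u ord0 ord0) real_adele).
      by apply: continuousD; [exact: cst_continuous|exact: coord_continuous].
    exact: real_adele_continuous.
  exact: sign_map_continuous.
- move=> j u v [_ u0] [_ v1] /quot_mapP[s].
  move=> /(congr1 (infty_coord S_infty)).
  rewrite /infty_coord /sign_act /adele_scale /real_adele /=.
  rewrite (ord1 j) in u0 v1; rewrite u0 v1; case: s => /=.
    by rewrite expr1 rmorphN1; lra.
  by rewrite expr0 rmorph1; lra.
Qed.

End AdeleSpace.

(** * The dimension of the homotopy quotient *)

Lemma pair_continuous (X Y Z : topologicalType) (f : X -> Y) (g : X -> Z) :
  continuous f -> continuous g -> continuous (fun x => (f x, g x)).
Proof. by move=> cf cg x; apply: cvg_pair; [exact: cf|exact: cg]. Qed.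

Section Hquotient.
Variables (R : realType) (S : {fset place}).
Local Notation A := (adeles R S).
Local Notation n := (fin_rank S).
Local Notation X := (A * 'rV[R]_n)%type.
Local Notation Y := (adele_hquotient R S).
Local Notation T := (sign_quotient R S).
Local Notation pi := (@adele_hquotient_map R S).
Local Notation GammaC := (bool * 'rV[int]_n)%type.

Lemma hquotient_mapP (a b : A) t s : pi (a, t) = pi (b, s) <->
  exists g : Gamma S, b = adele_scale (Gamma_val g) a /\ s = t + Gamma_translation R g.
Proof.
split=> [/quot_mapP[g [-> ->]]|[g [-> ->]]]; first by exists g.
by apply/quot_mapP; exists g.
Qed.

Lemma hquotient_ind (P : Y -> Prop) : (forall a t, P (pi (a, t))) -> forall y, P y.
Proof.
move=> H y; rewrite -[y](@quot_reprK _ _ (@hquotient_rel_equiv R S)).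
by case: (quot_repr y) => a t; exact: H.
Qed.

Lemma hquotient_map_continuous : continuous pi.
Proof. exact: quot_map_continuous. Qed.

Lemma hquotient_map_open (U : set X) : open U -> open (pi @` U).
Proof.
exact: (@quot_map_open X GammaC (@Gamma_act R S) _ (@hquotient_rel_equiv R S)
  (@hquotient_relE R S) (@Gamma_act_continuous R S)).
Qed.

Lemma hquotient_map_nbhs (x : X) (U : set X) : nbhs x U -> nbhs (pi x) (pi @` U).
Proof.
exact: (@quot_map_nbhs X GammaC (@Gamma_act R S) _ (@hquotient_rel_equiv R S)
  (@hquotient_relE R S) (@Gamma_act_continuous R S)).
Qed.

Lemma Gamma_translation0 e : Gamma_translation R ((e, 0) : Gamma S) = 0.
Proof. by apply/rowP => j; rewrite !mxE. Qed.

Lemma hquotient_map_sign e (a : A) t : pi (sign_act e a, t) = pi (a, t).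
Proof.
apply/esym/hquotient_mapP; exists (e, 0).
by rewrite Gamma_val_sign Gamma_translation0 addr0.
Qed.

Lemma Gamma_translation_lt1 (g : Gamma S) :
  (forall j, `|Gamma_translation R g ord0 j| < 1) -> g.2 = 0.
Proof.
move=> H; apply/rowP => j; rewrite [RHS]mxE; apply: (@intr_near_eq R).
by have := H j; rewrite mxE subr0.
Qed.

(** Points over a small ball of translation parameters are identified only by
    the sign. *)
Lemma hquotient_map_inj (a b : A) (t s : 'rV[R]_n) : (forall j, `|t ord0 j - s ord0 j| < 1) ->
  pi (a, t) = pi (b, s) -> t = s /\ sign_map a = sign_map b.
Proof.
move=> ts /hquotient_mapP[g [ba st]].
have g2 : g.2 = 0.
  apply: Gamma_translation_lt1 => j; have := ts j.
  by rewrite st mxE opprD addrA subrr sub0r normrN.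
case: g g2 ba st => e k /= -> ba st; split.
  by rewrite st Gamma_translation0 addr0.
by apply/quot_mapP; exists e; rewrite ba Gamma_val_sign.
Qed.

Lemma hquotient_refinable (S_infty : None \in S) : refinable Y n.+2.
Proof.
have [alpha aP] := exists_avoiding R n.+2.
apply: (@zero_dim_refinable Y n.+2 (fun i : 'I_n.+2 => pi @` (@adele_avoid R S (alpha i) `*`
  [set t : 'rV[R]_n | forall j, avoid (alpha i) (t ord0 j)]))).
  move=> i; apply: (@quot_zero_dim X GammaC (@Gamma_act R S) _ (@hquotient_rel_equiv R S)
    (@hquotient_relE R S) (@Gamma_act_continuous R S) _ (@Gamma_proper R S)).
    move=> g [a t] [/= aa tt]; split=> /=.
      by apply: adele_avoidM => //; exact: Gamma_val_neq0.
    by move=> j; rewrite !mxE -ratr_int; exact: avoidD.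
  by apply: zero_dimX; [exact: zero_dim_adele|apply: zero_dim_row; exact: zero_dim_avoid].
apply: hquotient_ind => a t.
have [|i Hi] := @avoid_pigeonhole _ n.+2 alpha (option 'I_n)
  (fun c => if c is Some j then t ord0 j else infty_coord S_infty a) aP.
  by rewrite card_option card_ord.
exists i, (a, t) => //; split=> /=; first exact: adele_avoid_infty (Hi None).
by move=> j; exact: (Hi (Some j)).
Qed.

Lemma hquotient_not_refinable (S_infty : None \in S) : ~ refinable Y n.+1.
Proof.
pose base (u : 'rV[R]_n.+1) : X :=
  (@real_adele R S (1 + u ord0 ord0), \row_j (u ord0 (lift ord0 j) / 2)).
have base_cont : continuous base.
  apply: pair_continuous => u.
    apply: (@continuous_comp _ _ _ (fun u : 'rV[R]_n.+1 => 1 + u ord0 ord0) (@real_adele R S)).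
      by apply: continuousD; [exact: cst_continuous|exact: coord_continuous].
    exact: real_adele_continuous.
  move=> U [P Pu PU].
  have H : nbhs u [set v : 'rV[R]_n.+1 | forall j, P ord0 j (v ord0 (lift ord0 j) / 2)].
    apply: (@filter_forall _ _ (fun j =>
      [set v : 'rV[R]_n.+1 | P ord0 j (v ord0 (lift ord0 j) / 2)]) (nbhs u)) => j.
    have := Pu ord0 j; rewrite mxE.
    have : {for u, continuous (fun v : 'rV[R]_n.+1 => v ord0 (lift ord0 j) / 2)}.
      by apply: continuousM; [exact: coord_continuous|exact: cst_continuous].
    by move=> /[apply].
  by apply: filterS H => v Hv; apply: PU => i j; rewrite (ord1 i) mxE.
apply: (@cube_not_refinable R n.+1 _ (pi \o base)).
- exact: hquotient_hausdorff.
- move=> u; apply: (@continuous_comp _ _ _ base pi); first exact: base_cont.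
  exact: hquotient_map_continuous.
move=> j u v [uc u0] [vc v1] /= uv.
(* Halving keeps the translations attached to two points of the cube less than 1
   apart. *)
have [|tt aa] := hquotient_map_inj _ uv.
  move=> i; rewrite !mxE -mulrBl normrM [ `|2^-1|]ger0_norm // ltr_pdivrMr // mul1r.
  have := uc (lift ord0 i); have := vc (lift ord0 i).
  by rewrite ltr_norml => /andP[? ?] /andP[? ?]; apply/andP; split; lra.
case: (unliftP ord0 j) => [i|] jE.
  have := congr1 (fun t : 'rV[R]_n => t ord0 i) tt.
  by rewrite !mxE -jE u0 v1 /=; lra.
move: aa => /quot_mapP[s] /(congr1 (infty_coord S_infty)).
rewrite /infty_coord /sign_act /adele_scale /real_adele /= -jE u0 v1.
by case: s; rewrite /= ?expr1 ?expr0 ?rmorphN1 ?rmorph1; lra.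
Qed.

(** * The lamination by translations *)

(** Two points of a ball of radius 1/4 cannot differ by a nonzero integral
    vector. *)
Definition lam_ball (c : 'rV[R]_n) : set 'rV[R]_n := ball c (1 / 4).

Definition lam_dom (c : 'rV[R]_n) : set Y := pi @` (setT `*` lam_ball c).

(** On [lam_dom c] the representative [x] exists and is unique up to sign; the
    default value only makes the function total. *)
Definition lam_chart (c : 'rV[R]_n) (y : Y) : 'rV[R]_n * T :=
  let x := xget (quot_repr y) [set x : X | lam_ball c x.2 /\ pi x = y] in
  (x.2, sign_map x.1).

Definition lam_chart_inv (c : 'rV[R]_n) (z : 'rV[R]_n * T) : Y :=
  pi (quot_repr z.2, z.1).

Lemma lam_ballP c t : lam_ball c t <-> forall j, `|c ord0 j - t ord0 j| < 1 / 4.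
Proof.
split=> [[_ H] j|H]; first exact: H.
by split=> [|i j]; [lra|rewrite (ord1 i); exact: H].
Qed.

Lemma lam_ball_center c : lam_ball c c.
Proof. by apply: ballxx; lra. Qed.

Lemma lam_ball_open c : open (lam_ball c).
Proof.
rewrite openE => t /lam_ballP tc.
have H : nbhs t [set s : 'rV[R]_n | forall j, ball (c ord0 j) (1 / 4) (s ord0 j)].
  apply: (@filter_forall _ _ (fun j =>
    [set s : 'rV[R]_n | ball (c ord0 j) (1 / 4) (s ord0 j)]) (nbhs t)) => j.
  apply: (@coord_continuous R 1 n ord0 j t); apply: open_nbhs_nbhs; split; last exact: tc.
  exact: ball_open.
by apply: filterS H => s Hs; apply/lam_ballP.
Qed.

Lemma lam_chartE c (a : A) t : lam_ball c t ->
  lam_chart c (pi (a, t)) = (t, sign_map a).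
Proof.
move=> ct; rewrite /lam_chart; case: xgetP => [[b s] _ [/= cs E]|/(_ (a, t))]; last first.
  by move=> /= H; case: H.
have [|-> ->] := hquotient_map_inj _ E => //.
move=> j; move/lam_ballP: ct => /(_ j); move/lam_ballP: cs => /(_ j).
rewrite !ltr_norml => /andP[? ?] /andP[? ?]; apply/andP; split; lra.
Qed.

Lemma lam_chart_invE c (a : A) t : lam_chart_inv c (t, sign_map a) = pi (a, t).
Proof.
rewrite /lam_chart_inv /=; have /quot_mapP[s] := quot_reprK (sign_map a).
set b := quot_repr _ => ->.
by rewrite hquotient_map_sign.
Qed.

Lemma lam_dom_open c : open (lam_dom c).
Proof.
apply: hquotient_map_open; rewrite openE => -[a t] [_ /= ct].
exists (setT, lam_ball c) => //=; split; first exact: filterT.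
by apply: open_nbhs_nbhs; split => //; exact: lam_ball_open.
Qed.

Lemma lam_domE c (a : A) t : lam_ball c t -> lam_dom c (pi (a, t)).
Proof. by move=> ct; exists (a, t). Qed.

Lemma lam_dom_cover : \bigcup_c lam_dom c = [set: Y].
Proof.
apply/seteqP; split=> // y _; elim/hquotient_ind: y => a t.
by exists t => //; apply: lam_domE; exact: lam_ball_center.
Qed.

Lemma lam_homeo c : homeomorphism_on (lam_dom c) (lam_ball c `*` setT)
  (lam_chart c) (@lam_chart_inv c).
Proof.
have signK (z : T) : exists a, z = sign_map a.
  by exists (quot_repr z); rewrite [RHS]quot_reprK.
split.
- by move=> _ [[a t] [_ ct] <-]; rewrite lam_chartE.
- move=> [t z] [/= ct _]; have [a ->] := signK z.
  by rewrite lam_chart_invE; exact: lam_domE.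
- split=> [y|[t z]]; rewrite inE; first by move=> [[a t] [_ ct] <-]; rewrite lam_chartE // lam_chart_invE.
  by move=> [/= ct _]; have [a ->] := signK z; rewrite lam_chart_invE lam_chartE.
- apply: continuous_in_subspaceT => y; rewrite inE => -[[a t] [_ /= ct] <-] U.
  rewrite /= lam_chartE // => -[[N N'] /= [Nt N'a] NU].
  have H : nbhs ((a, t) : X) ((@sign_map R S @^-1` N') `*` (N `&` lam_ball c)).
    exists (@sign_map R S @^-1` N', N `&` lam_ball c) => //=.
    split; first exact: (@sign_map_continuous R S a _ N'a).
    by apply: filterI => //; apply: open_nbhs_nbhs; split => //; exact: lam_ball_open.
  apply: filterS (hquotient_map_nbhs H) => _ [[b s] [/= ? [? ?]] <-].
  by rewrite /= lam_chartE //; apply: NU.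
- apply: continuous_in_subspaceT => -[t z] _ U; have [a ->] := signK z.
  rewrite /= lam_chart_invE => Ua.
  have : nbhs ((a, t) : X) (pi @^-1` U) by exact: (@hquotient_map_continuous (a, t) _ Ua).
  move=> [[N N'] /= [Na N't] NU].
  exists (N', @sign_map R S @` N) => /=.
    split=> //; exact: (@quot_map_nbhs A bool _ _ (@sign_rel_equiv R S)
      (@sign_relE R S) (@sign_act_continuous R S)).
  by move=> [s _] [/= N's [b Nb <-]]; rewrite /= lam_chart_invE; apply: NU.
Qed.

Lemma lam_chart_change c d (y : Y) : lam_dom c y -> lam_dom d y ->
  exists V (h : T -> T), [/\ open V, V y, V `<=` lam_dom c `&` lam_dom d &
    forall x, V x -> (lam_chart d x).2 = h (lam_chart c x).2].
Proof.
move=> [[a t] [_ /= ct] <-] [[b s] [_ /= ds] /esym/hquotient_mapP[g [ba st]]].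
(* The element [g] compares the representatives of [y] in the two charts; on the
   set [W] it still does. *)
pose W : set X := setT `*` (lam_ball c `&` (fun u => u + Gamma_translation R g) @^-1` lam_ball d).
have piE a' t' : pi (a', t') = pi (adele_scale (Gamma_val g) a', t' + Gamma_translation R g).
  by apply/hquotient_mapP; exists g.
have hE a' t' : lam_ball c t' -> lam_ball d (t' + Gamma_translation R g) ->
    (lam_chart d (pi (a', t'))).2 =
    sign_map (adele_scale (Gamma_val g) (quot_repr (lam_chart c (pi (a', t'))).2)).
  move=> ct' dt'; rewrite (@lam_chartE c) // piE (@lam_chartE d) //=.
  have /quot_mapP[e] := quot_reprK (sign_map a').
  set a'' := quot_repr _ => ->; apply/esym/quot_mapP; exists e.
  by rewrite /sign_act -!adele_scaleM mulrC.
exists (pi @` W), (fun z => sign_map (adele_scale (Gamma_val g) (quot_repr z))); split.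
- apply: hquotient_map_open; rewrite openE => -[a' t'] [_ [/= ct' dt']].
  exists (setT, lam_ball c `&` (fun u => u + Gamma_translation R g) @^-1` lam_ball d) => //=.
  split; first exact: filterT.
  apply: filterI; first by apply: open_nbhs_nbhs; split => //; exact: lam_ball_open.
  have tc : continuous (fun u : 'rV[R]_n => u + Gamma_translation R g).
    by move=> u; apply: continuousD; [exact: cvg_id|exact: cst_continuous].
  by apply: tc; apply: open_nbhs_nbhs; split => //; exact: lam_ball_open.
- by exists (a, t) => //; split => //; split => //=; rewrite -st.
- move=> _ [[a' t'] [_ [/= ct' dt']] <-]; split; first exact: lam_domE.
  by rewrite piE; exact: lam_domE.
- by move=> _ [[a' t'] [_ [ct' dt']] <-]; exact: hE.
Qed.

Definition translation_lamination : lamination R n Y :=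
  Lamination lam_dom_open lam_dom_cover
    (fun c => ex_intro _ c (ex_intro _ (1 / 4) (conj (divr_gt0 ltr01 (ltr0n _ 4)) erefl)))
    lam_homeo lam_chart_change.

Local Notation L := translation_lamination.

Lemma translateD v w (y : Y) : translate v (translate w y) = translate (w + v) y.
Proof. by elim/hquotient_ind: y => a t; rewrite !translate_map addrA. Qed.

Lemma translate0 (y : Y) : translate 0 y = y.
Proof. by elim/hquotient_ind: y => a t; rewrite translate_map addr0. Qed.

Lemma same_plaque_translate (y z : Y) : same_plaque L y z -> exists v, z = translate v y.
Proof.
move=> [c [[[a t] [_ ct] <-] [[b s] [_ cs] <-] E]].
have {E} : (lam_chart c (pi (a, t))).2 = (lam_chart c (pi (b, s))).2 := E.
rewrite !lam_chartE // => /quot_mapP[e ->]; exists (s - t).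
by rewrite translate_map addrC subrK hquotient_map_sign.
Qed.

Lemma translate_small_plaque (y : Y) (v : 'rV[R]_n) :
  (forall j, `|v ord0 j| < 1 / 4) -> same_plaque L y (translate v y).
Proof.
elim/hquotient_ind: y => a t vs; rewrite translate_map; exists t.
have tv : lam_ball t (t + v).
  by apply/lam_ballP => j; rewrite mxE opprD addrA subrr sub0r normrN.
have tt := lam_ball_center t.
have E : (lam_chart t (pi (a, t))).2 = (lam_chart t (pi (a, t + v))).2.
  by rewrite !lam_chartE.
by split; [exact: lam_domE|exact: lam_domE|exact: E].
Qed.

(** A translation is a composite of small ones, and each small translation moves
    a point inside the chart centred at it. *)
Lemma same_leafP (y z : Y) : same_leaf L y z <-> exists v, z = translate v y.
Proof.
split.
  elim=> {y z} [y z|y|y z _ [v ->]|y z w _ [u ->] _ [v ->]].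
  - exact: same_plaque_translate.
  - by exists 0; rewrite translate0.
  - by exists (- v); rewrite translateD subrr translate0.
  - by exists (u + v); rewrite translateD.
move=> [v ->].
pose k := (\max_(j < n) Num.bound (`|v ord0 j| * 4))%N.
have [u us vu] : exists2 u : 'rV[R]_n, (forall j, `|u ord0 j| < 1 / 4) & v = u *+ k.+1.
  exists (k.+1%:R^-1 *: v) => [j|]; last first.
    by rewrite -scaler_nat scalerA divff ?scale1r // pnatr_eq0.
  rewrite mxE normrM ger0_norm ?invr_ge0 // mulrC ltr_pdivrMr ?ltr0n //.
  have h := archi_boundP (mulr_ge0 (normr_ge0 (v ord0 j)) (ler0n R 4)).
  have : (Num.bound (`|v ord0 j| * 4))%:R <= k.+1%:R :> R.
    by rewrite ler_nat; apply: leqW; exact: leq_bigmax.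
  by move: h; set x := (Num.bound _)%:R; lra.
rewrite vu; elim: k.+1 => [|m IH]; first by rewrite mulr0n translate0; exact: rst_refl.
rewrite mulrSr -translateD; apply: rst_trans IH _; apply: rst_step.
exact: translate_small_plaque.
Qed.

Lemma lamination_by_translations : defined_by_action L (@translate R S).
Proof.
split; first exact: same_leafP.
suff H c a t v : lam_ball c t -> lam_ball c ((lam_chart c (pi (a, t))).1 + v) ->
    lam_dom c (translate v (pi (a, t))) /\ lam_chart c (translate v (pi (a, t))) =
    ((lam_chart c (pi (a, t))).1 + v, (lam_chart c (pi (a, t))).2).
  by move=> c _ v [[a t] [_ ct] <-]; exact: H.
move=> ct; rewrite lam_chartE // => cv.
by rewrite translate_map lam_chartE //; split=> //; exact: lam_domE.
Qed.

Definition leaf_to_quotient (z : leaf_space L) : adele_quotient R S :=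
  adele_quotient_map (quot_repr (quot_repr z)).1.

Definition quotient_to_leaf (w : adele_quotient R S) : leaf_space L :=
  leaf_map L (pi (quot_repr w, 0)).

Lemma leaf_mapP (y z : Y) : leaf_map L y = leaf_map L z <-> exists v, z = translate v y.
Proof. by rewrite -same_leafP; exact: quot_mapP. Qed.

Lemma leaf_to_quotientE (a : A) t :
  leaf_to_quotient (leaf_map L (pi (a, t))) = adele_quotient_map a.
Proof.
rewrite /leaf_to_quotient; set z := quot_repr (leaf_map _ _).
have /leaf_mapP[v] : leaf_map L z = leaf_map L (pi (a, t)) by exact: quot_reprK.
rewrite -{1}[z](@quot_reprK _ _ (@hquotient_rel_equiv R S)).
case: (quot_repr z) => b s /=; rewrite translate_map => /esym/hquotient_mapP[g [-> _]].
by apply/quot_mapP; exists g.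
Qed.

Lemma quotient_to_leafE (a : A) t :
  quotient_to_leaf (adele_quotient_map a) = leaf_map L (pi (a, t)).
Proof.
rewrite /quotient_to_leaf; have /quot_mapP[g] := quot_reprK (adele_quotient_map a).
set b := quot_repr _ => ->; apply/leaf_mapP; exists (t - Gamma_translation R g).
rewrite translate_map add0r; apply/esym/hquotient_mapP; exists g.
by rewrite subrK.
Qed.

Lemma leaf_to_quotient_homeo : is_homeomorphism leaf_to_quotient.
Proof.
exists quotient_to_leaf; split=> //.
- split=> [z _|w _].
    rewrite -[z]quot_reprK; move: (quot_repr z); apply: hquotient_ind => a t.
    by rewrite leaf_to_quotientE (quotient_to_leafE a t).
  by rewrite -[w]quot_reprK (quotient_to_leafE _ 0) leaf_to_quotientE.
- apply: continuous_subspaceT; apply: quot_continuous; apply: quot_continuous.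
  rewrite (_ : _ \o _ = @adele_quotient_map R S \o fst).
    move=> x; apply: continuous_comp; first exact: cvg_fst.
    exact: quot_map_continuous.
  by apply/funext => -[a t]; exact: leaf_to_quotientE.
- apply: continuous_subspaceT; apply: quot_continuous.
  have c0 : continuous (fun a : A => ((a, 0) : X)).
    by apply: pair_continuous => b; [exact: cvg_id|exact: cst_continuous].
  rewrite (_ : _ \o _ = leaf_map L \o pi \o (fun a => (a, 0))).
    move=> a; apply: continuous_comp; first exact: c0.
    by apply: continuous_comp; exact: quot_map_continuous.
  by apply/funext => a; exact: quotient_to_leafE.
Qed.

End Hquotient.

Theorem proposition6p1 (R : realType) (S : {fset place}) (S_infty : None \in S) :
  [/\ hausdorff_space (adele_hquotient R S),
      locally_compact [set: adele_hquotient R S] &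
      has_covering_dim (adele_hquotient R S) #|` S|]
  /\
  (exists L : lamination R (fin_rank S) (adele_hquotient R S),
    [/\ has_codim L 1,
        defined_by_action L (@translate R S) &
        exists h : leaf_space L -> adele_quotient R S,
          is_homeomorphism h /\
          forall (a : adeles R S) (t : 'rV[R]_(fin_rank S)),
            h (leaf_map L (adele_hquotient_map (a, t))) = adele_quotient_map a]).
Proof.
split.
  split; [exact: hquotient_hausdorff|exact: hquotient_locally_compact|].
  rewrite card_places //; split; first exact: hquotient_refinable.
  exact: hquotient_not_refinable.
exists (translation_lamination R S); split.
- by move=> c; exact: sign_quotient_dim.
- exact: lamination_by_translations.
- exists (@leaf_to_quotient R S); split; first exact: leaf_to_quotient_homeo.
  exact: leaf_to_quotientE.
Qed.
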